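(* Every $p$-Mahler equation $$a_0(z)f(z)+a_1(z)f(z^{p})+\cdots+a_d(z)f(z^{p^d})=0,\qquad a_0,\ldots,a_d\in\mathbb{K}_\infty,\ a_0a_d\neq 0,$$ has a full basis of generalized $p$-Mahler series solutions, i.e. there exist $d$ generalized $p$-Mahler series $y_1,\ldots,y_d\in\mathcal{R}$ which are solutions of the equation and are $\overline{\mathbb{Q}}$-linearly independent.
   Context: Fix an integer $p\ge 2$. $\overline{\mathbb{Q}}$ is the field of algebraic numbers; $\mathbb{K}_\infty=\bigcup_{k\ge1}\overline{\mathbb{Q}}(z^{1/k})$; $\mathcal{P}=\bigcup_{k\ge1}\overline{\mathbb{Q}}((z^{1/k}))$ is the field of Puiseux series; $\mathscr{H}=\overline{\mathbb{Q}}((z^{\mathbb{Q}}))$ is the field of Hahn series, i.e. formal sums $\sum_{\gamma\in\mathbb{Q}}f_\gamma z^\gamma$ ($f_\gamma\in\overline{\mathbb{Q}}$) with well-ordered support, with the usual sum and product. $\phi_p$ is the field automorphism of $\mathscr{H}$ sending $\sum f_\gamma z^\gamma$ to $\sum f_\gamma z^{p\gamma}$ (so $f(z^p)=\phi_p(f)$); it restricts to automorphisms of $\mathcal{P}$ and $\mathbb{K}_\infty$. A $p$-Mahler Puiseux series is an element $f\in\mathcal{P}$ satisfying some equation $a_0f+a_1\phi_p(f)+\cdots+a_d\phi_p^d(f)=0$ with $a_i\in\mathbb{K}_\infty$, $a_0a_d\neq0$. Let $(\mathcal{R},\phi_p)$ be a difference ring extension of $(\mathscr{H},\phi_p)$ (a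 commutative ring containing $\mathscr{H}$ with a ring automorphism extending $\phi_p$) whose ring of constants $\{f\in\mathcal{R}:\phi_p(f)=f\}$ is $\overline{\mathbb{Q}}$, containing an element $\ell$ with $\phi_p(\ell)=\ell+1$ and, for each $c\in\overline{\mathbb{Q}}^\times$, an invertible element $e_c$ with $\phi_p(e_c)=ce_c$. Let $\boldsymbol\Lambda=\bigcup_{t\ge0}\boldsymbol\Lambda_t$ with $\boldsymbol\Lambda_t=\mathbb{Z}_{\ge0}^t\times(\overline{\mathbb{Q}}^\times)^t\times\mathbb{Q}_{>0}^t$. For $\boldsymbol\omega=((\alpha_1,\ldots,\alpha_t),(\lambda_1,\ldots,\lambda_t),(a_1,\ldots,a_t))\in\boldsymbol\Lambda_t$ with $t\ge1$, set $$\xi_{\boldsymbol\omega}=\sum_{k_1,\ldots,k_t\ge1}k_1^{\alpha_1}\cdots k_t^{\alpha_t}\lambda_1^{k_1}\lambda_2^{k_1+k_2}\cdots\lambda_t^{k_1+\cdots+k_t}z^{-\frac{a_1}{p^{k_1}}-\frac{a_2}{p^{k_1+k_2}}-\cdots-\frac{a_t}{p^{k_1+\cdots+k_t}}}\in\mathscr{H},$$ and for the unique element of $\boldsymbol\Lambda_0$ set $\xi=1$. A generalized $p$-Mahler series is an element of $\mathcal{R}$ of the form $\sum_{(c,j)\in\overline{\mathbb{Q}}^\times\times\mathbb{Z}_{\ge0}}\sum_{\boldsymbol\omega\in\boldsymbol\Lambda}f_{c,j,\boldsymbol\omega}\xi_{\boldsymbol\omega}e_c\ell^j$ where the sums have finite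 support and each $f_{c,j,\boldsymbol\omega}$ is a $p$-Mahler Puiseux series. *)

(* Defs.v *)
From HB Require Import structures.
From mathcomp Require Import all_boot all_order all_algebra all_field.
From mathcomp Require Import finmap all_classical.

Set Implicit Arguments.
Unset Strict Implicit.
Unset Printing Implicit Defensive.

Import Order.TTheory GRing.Theory Num.Theory.
Local Open Scope classical_set_scope.
Local Open Scope ring_scope.

(* The field of algebraic numbers is algC throughout. *)

Definition well_ordered (A : set rat) : Prop :=
  forall B : set rat, B `<=` A -> B !=set0 ->
    exists2 m, B m & forall x, B x -> m <= x.

Lemma well_orderedS (A B : set rat) :
  A `<=` B -> well_ordered B -> well_ordered A.
Proof. by move=> sAB woB C sCA; apply: woB => x /sCA/sAB. Qed.

Lemma well_ordered0 : well_ordered set0.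
Proof. by move=> B sB [x /sB]. Qed.

Lemma well_ordered1 a : well_ordered [set a].
Proof. by move=> B sB [x Bx]; exists x => // y /sB ->; rewrite (sB _ Bx). Qed.

Lemma well_orderedU (A B : set rat) :
  well_ordered A -> well_ordered B -> well_ordered (A `|` B).
Proof.
move=> woA woB C sC [x Cx].
have [[y [Cy Ay]]|nA] := pselect (C `&` A !=set0); last first.
  apply: woB; last by exists x.
  by move=> y Cy; have [Ay|//] := sC _ Cy; case: nA; exists y.
have [[w [Cw Bw]]|nB] := pselect (C `&` B !=set0); last first.
  apply: woA; last by exists x.
  by move=> v Cv; have [//|Bv] := sC _ Cv; case: nB; exists v.
have [||a [Ca Aa] amin] := woA (C `&` A); first by move=> ? [].
  by exists y.
have [||b [Cb Bb] bmin] := woB (C `&` B); first by move=> ? [].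
  by exists w.
exists (Num.min a b); first by case: leP.
move=> v Cv; rewrite ge_min; have [Av|Bv] := sC _ Cv.
  by rewrite amin.
by rewrite bmin ?orbT.
Qed.

Definition sumset (A B : set rat) : set rat :=
  [set x | exists a b, [/\ A a, B b & x = a + b]].

Lemma well_ordered_sumset (A B : set rat) :
  well_ordered A -> well_ordered B -> well_ordered (sumset A B).
Proof.
move=> woA woB D sD D0.
pose N a b := [/\ A a, B b, D (a + b) & forall a' b', A a' -> B b' ->
  D (a' + b') -> a' + b' <= a + b -> a <= a'].
have NP x : D x -> exists a b, N a b /\ a + b <= x.
  move=> Dx; pose S := [set a | A a /\ exists2 b, B b & D (a + b) /\ a + b <= x].
  have [||a [Aa [b Bb [Dab abx]]] amin] := woA S; first by move=> ? [].
    by have [a [b [Aa Bb xE]]] := sD _ Dx; exists a; split=> //; exists b;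
       rewrite -?xE.
  exists a, b; split=> //; split=> // a' b' Aa' Bb' Dab' le_ab.
  by apply: amin; split=> //; exists b' => //; split=> //; apply: le_trans abx.
have [||b0 [a0 N0] b0min] := woB [set b | exists a, N a b].
- by move=> b [a []].
- by have [x Dx] := D0; have [a [b [Nab _]]] := NP x Dx; exists b, a.
case: (N0) => Aa0 Bb0 D0' a0min.
exists (a0 + b0) => // x Dx; rewrite leNgt; apply/negP => ltx.
have [a1 [b1 [N1 le1]]] := NP _ Dx; case: (N1) => Aa1 Bb1 D1 _.
have lt1 := le_lt_trans le1 ltx.
have le_a := a0min _ _ Aa1 Bb1 D1 (ltW lt1).
have le_b : b0 <= b1 by apply: b0min; exists a1.
by have := lerD le_a le_b; rewrite leNgt lt1.
Qed.

Lemma well_ordered_finite (S : set rat) : well_ordered S ->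
  well_ordered (-%R @` S) -> finite_set S.
Proof.
move=> woS woN.
have maxS (B : set rat) : B `<=` S -> B !=set0 ->
    exists2 m, B m & forall x, B x -> x <= m.
  move=> sB [x Bx]; have [||m [y By <-] mmin] := woN (-%R @` B).
  - by move=> _ [y /sB Sy <-]; exists y.
  - by exists (- x), x.
  by exists y => // v Bv; rewrite -lerN2; apply: mmin; exists v.
have [S0|/set0P/(maxS S (fun _ => id))[M SM Mmax]] := eqVneq S set0.
  by rewrite S0.
apply: contrapT => infS.
pose T := [set x | S x /\ ~ finite_set (S `&` [set y | y <= x])].
have [||m [Sm infm] mmin] := woS T; first by move=> ? [].
  exists M; split=> // fin; apply: infS; apply: sub_finite_set fin.
  by move=> x Sx; split=> //; apply: Mmax.
have [S0|/set0P/(maxS _)[]] := eqVneq (S `&` [set y | y < m]) set0.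
- apply: infm; apply: sub_finite_set (finite_set1 m) => x [Sx /= xm].
  apply/eqP; rewrite eq_le xm leNgt; apply/negP => ltx.
  by have : (S `&` [set y | y < m]) x by []; rewrite S0.
- by move=> ? [].
move=> m' [Sm' ltm'] m'max.
suff : T m' by move/mmin; rewrite leNgt ltm'.
split=> // fin; apply: infm.
apply: (@sub_finite_set _ _ ((S `&` [set y | y <= m']) `|` [set m])); last first.
  by rewrite finite_setU; split=> //; apply: finite_set1.
move=> x [Sx /= xm]; have [->|xneq] := eqVneq x m; first by right.
by left; split=> //; apply: m'max; split=> //=; rewrite lt_neqAle xneq.
Qed.

Lemma finite_sum_fiber (A B : set rat) x : well_ordered A -> well_ordered B ->
  finite_set [set a | A a /\ B (x - a)].
Proof.
move=> woA woB; apply: well_ordered_finite.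
  by apply: well_orderedS woA => a [].
apply: well_orderedS (well_ordered_sumset (@well_ordered1 (- x)) woB).
by move=> _ [a [_ Ba] <-]; exists (- x), (x - a); split=> //; rewrite addKr.
Qed.

Lemma fsumT_fset (V : zmodType) (I : choiceType) (A : set I) (F : I -> V) :
  finite_set A -> (forall i, F i != 0 -> A i) ->
  \sum_(i \in setT) F i = \sum_(i <- fset_set A) F i.
Proof.
move=> finA sA; rewrite -fsbig_finite //; apply/esym.
apply: fsbig_widen => // i [_ nAi] /=.
by apply/eqP; apply: contra_notT nAi => /sA.
Qed.

Lemma fsumT1 (V : zmodType) (I : choiceType) (j : I) (F : I -> V) :
  (forall i, i != j -> F i = 0) -> \sum_(i \in setT) F i = F j.
Proof.
move=> F0; rewrite (@fsumT_fset _ _ [set j]) ?fset_set1 ?big_seq_fset1 //.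
by move=> i; apply: contra_neqP => /eqP/F0.
Qed.

Record hahn := Hahn {
  hcoef :> rat -> algC;
  hahn_supp : well_ordered [set g | hcoef g != 0]
}.
Arguments hahn_supp : clear implicits.

Lemma hahnP (f g : hahn) : (forall x, f x = g x) <-> f = g.
Proof.
split=> [|-> //]; case: f g => [f pf] [g pg] /= /funext fg.
by subst g; congr Hahn; apply: Prop_irrelevance.
Qed.

HB.instance Definition _ := gen_eqMixin hahn.
HB.instance Definition _ := gen_choiceMixin hahn.

Section HahnZmodule.
Implicit Types f g h : hahn.

Fact hahn0_subproof : well_ordered [set x : rat | (0 : algC) != 0].
Proof. by apply: (well_orderedS _ well_ordered0) => x /=; rewrite eqxx. Qed.
Definition hahn0 : hahn := Hahn hahn0_subproof.

Fact hahnN_subproof f : well_ordered [set x | - f x != 0].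
Proof.
by apply: well_orderedS (hahn_supp f) => x /=; rewrite oppr_eq0.
Qed.
Definition hahnN f : hahn := Hahn (@hahnN_subproof f).

Fact hahnD_subproof f g : well_ordered [set x | f x + g x != 0].
Proof.
apply: well_orderedS (well_orderedU (hahn_supp f) (hahn_supp g)) => x /=.
by have [->|fx _] := eqVneq (f x) 0; [rewrite add0r; right | left].
Qed.
Definition hahnD f g : hahn := Hahn (@hahnD_subproof f g).

Fact hahnDA : associative hahnD.
Proof. by move=> f g h; apply/hahnP => x /=; rewrite addrA. Qed.
Fact hahnDC : commutative hahnD.
Proof. by move=> f g; apply/hahnP => x /=; rewrite addrC. Qed.
Fact hahn0D : left_id hahn0 hahnD.
Proof. by move=> f; apply/hahnP => x /=; rewrite add0r. Qed.
Fact hahnND : left_inverse hahn0 hahnN hahnD.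
Proof. by move=> f; apply/hahnP => x /=; rewrite addNr. Qed.

End HahnZmodule.

HB.instance Definition _ :=
  GRing.isZmodule.Build hahn hahnDA hahnDC hahn0D hahnND.

Lemma hcoef0 x : (0 : hahn) x = 0. Proof. by []. Qed.
Lemma hcoefN (f : hahn) x : (- f) x = - f x. Proof. by []. Qed.
Lemma hcoefD (f g : hahn) x : (f + g) x = f x + g x. Proof. by []. Qed.
Lemma hcoef_sum I (r : seq I) (P : pred I) (F : I -> hahn) x :
  (\sum_(i <- r | P i) F i) x = \sum_(i <- r | P i) F i x.
Proof. exact: (big_morph (fun f : hahn => f x) (fun f g => hcoefD f g x)). Qed.

(* c z^q *)
Fact hmonom_subproof (c : algC) (q : rat) :
  well_ordered [set x | (if x == q then c else 0) != 0].
Proof.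
apply: well_orderedS (@well_ordered1 q) => x /=.
by case: (x =P q) => // _; rewrite eqxx.
Qed.
Definition hmonom (c : algC) (q : rat) : hahn := Hahn (@hmonom_subproof c q).

Section HahnMul.
Implicit Types f g h : hahn.

Lemma hmul_finite f g x : finite_set [set a | f a != 0 /\ g (x - a) != 0].
Proof. exact: finite_sum_fiber (hahn_supp f) (hahn_supp g). Qed.

(* Only finitely many terms of the sum are nonzero, by hmul_finite. *)
Definition hmul_coef f g (x : rat) : algC :=
  \sum_(a \in setT) f a * g (x - a).

Lemma hmul_coef_supp f g x : hmul_coef f g x != 0 ->
  sumset [set y | f y != 0] [set y | g y != 0] x.
Proof.
apply: contra_neqP => nS; rewrite /hmul_coef fsbig1 // => a _.
have [->|fa] := eqVneq (f a) 0; first by rewrite mul0r.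
have [->|ga] := eqVneq (g (x - a)) 0; first by rewrite mulr0.
by case: nS; exists a, (x - a); split=> //; rewrite addrC subrK.
Qed.

Fact hahnM_subproof f g : well_ordered [set x | hmul_coef f g x != 0].
Proof.
apply: well_orderedS (well_ordered_sumset (hahn_supp f) (hahn_supp g)).
by move=> x; apply: hmul_coef_supp.
Qed.
Definition hahnM f g : hahn := Hahn (@hahnM_subproof f g).

Fact hahnMC : commutative hahnM.
Proof.
move=> f g; apply/hahnP => x /=; rewrite /hmul_coef.
rewrite (@reindex_fsbigT _ _ _ _ _ (fun a => x - a)).
  by apply: eq_fsbigr => a _; rewrite subKr mulrC.
by exists (fun a => x - a) => a; rewrite subKr.
Qed.

Fact hahnMDl : left_distributive hahnM hahnD.
Proof.
move=> f g h; apply/hahnP => x /=; rewrite /hmul_coef.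
pose A := [set a | f a != 0 /\ h (x - a) != 0] `|`
          [set a | g a != 0 /\ h (x - a) != 0].
have finA : finite_set A by rewrite finite_setU; split; apply: hmul_finite.
have [sf sg] : (forall a, f a * h (x - a) != 0 -> A a) /\
               (forall a, g a * h (x - a) != 0 -> A a).
  by split=> a; rewrite mulf_eq0 negb_or => /andP[? ?]; [left|right].
rewrite !(@fsumT_fset _ _ A) //.
  by rewrite -big_split; apply: eq_bigr => a _; rewrite mulrDl.
move=> a; rewrite mulrDl.
have [->|? _] := eqVneq (f a * h (x - a)) 0; last exact: sf.
by rewrite add0r; apply: sg.
Qed.

Fact hahn1M : left_id (hmonom 1 0) hahnM.
Proof.
move=> f; apply/hahnP => x /=; rewrite /hmul_coef (@fsumT1 _ _ 0) /=.
  by rewrite mul1r subr0.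
by move=> a /negPf ->; rewrite mul0r.
Qed.

Fact hahnMA : associative hahnM.
Proof.
move=> f g h; apply/hahnP => x /=; apply/esym; rewrite /hmul_coef /=.
pose F a y := f a * g (y - a) * h (x - y).
pose Y := [set y | sumset [set y | f y != 0] [set y | g y != 0] y /\
                   h (x - y) != 0].
have finY : finite_set Y.
  apply: finite_sum_fiber (hahn_supp h).
  exact: well_ordered_sumset (hahn_supp f) (hahn_supp g).
pose A := \bigcup_(y in Y) [set a | f a != 0 /\ g (y - a) != 0].
have finA : finite_set A.
  by apply: bigcup_finite => // y _; apply: hmul_finite.
have FP a y : F a y != 0 -> A a /\ Y y.
  rewrite /F !mulf_eq0 !negb_or => /andP[/andP[fa ga] hy].
  suff Yy : Y y by split=> //; exists y.
  by split=> //; exists a, (y - a); split=> //; rewrite addrC subrK.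
transitivity (\sum_(y <- fset_set Y) \sum_(a <- fset_set A) F a y).
  rewrite (@fsumT_fset _ _ Y) //; last first.
    by move=> y; rewrite mulf_eq0 negb_or => /andP[/hmul_coef_supp ? ?].
  apply: eq_big_seq => y; rewrite in_fset_set // inE => Yy.
  rewrite /hmul_coef (@fsumT_fset _ _ A) ?mulr_suml // => a.
  by rewrite mulf_eq0 negb_or => /andP[? ?]; exists y.
rewrite exchange_big /=; apply/esym.
have innerE a : f a * \sum_(b \in setT) g b * h (x - a - b) =
    \sum_(y \in setT) F a y.
  rewrite mulr_fsumr (@reindex_fsbigT _ _ _ _ _ (fun y => y - a)).
    apply: eq_fsbigr => y _; rewrite /F mulrA; congr (_ * h _).
    by rewrite opprB addrA subrK.
  by exists (fun y => y + a) => y; rewrite ?addrK ?subrK.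
rewrite (@fsumT_fset _ _ A) //; last first.
  move=> a; rewrite [X in f a * X]/hmul_coef innerE; apply: contra_neqP => nA.
  by rewrite fsbig1 // => y _; apply/eqP; apply: contra_notT nA => /FP[].
apply: eq_bigr => a _; rewrite [X in f a * X]/hmul_coef innerE.
by rewrite (@fsumT_fset _ _ Y) // => y /FP[].
Qed.

Fact hahn1_neq0 : hmonom 1 0 != 0.
Proof.
by apply/eqP => /hahnP/(_ 0)/eqP; apply/negP/oner_neq0.
Qed.

End HahnMul.

HB.instance Definition _ := GRing.Zmodule_isComNzRing.Build hahn
  hahnMA hahnMC hahn1M hahnMDl hahn1_neq0.

Section HahnField.
Implicit Types f g h : hahn.

Lemma hcoefM f g x : (f * g) x = \sum_(a \in setT) f a * g (x - a).
Proof. by []. Qed.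

Lemma hcoef1 x : (1 : hahn) x = if x == 0 then 1 else 0.
Proof. by []. Qed.

Lemma hcoef_monomM c q f x : (hmonom c q * f) x = c * f (x - q).
Proof.
rewrite hcoefM (@fsumT1 _ _ q) /= ?eqxx // => a /negPf ->.
by rewrite mul0r.
Qed.

Definition supp_ge (m : rat) f := forall x, f x != 0 -> m <= x.

Lemma supp_geM a b f g : supp_ge a f -> supp_ge b g -> supp_ge (a + b) (f * g).
Proof.
by move=> fa gb x /hmul_coef_supp [y [w [/fa ya /gb wb ->]]]; apply: lerD.
Qed.

Lemma supp_geX m f n : supp_ge m f -> supp_ge (m *+ n) (f ^+ n).
Proof.
move=> fm; elim: n => [|n IHn].
  by move=> x; rewrite hcoef1 mulr0n; case: (x =P 0) => [->|]; rewrite ?eqxx.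
by rewrite exprS mulrS; apply: supp_geM.
Qed.

Lemma supp_min f : f != 0 -> exists2 m, f m != 0 & supp_ge m f.
Proof.
move=> f0; have [||m fm mmin] := hahn_supp f ([set x | f x != 0]).
- by [].
- apply: contrapT => nf; case/eqP: f0; apply/hahnP => x.
  by apply/eqP; apply: contra_notT nf => fx; exists x.
- by exists m.
Qed.

Lemma hcoefM_agree f g h x : supp_ge 0 h -> (forall y, y <= x -> f y = g y) ->
  (f * h) x = (g * h) x.
Proof.
move=> h0 fg; rewrite !hcoefM; apply: eq_fsbigr => a _.
have [le_ax|lt_xa] := leP a x; first by rewrite fg.
have [->|/h0] := eqVneq (h (x - a)) 0; first by rewrite !mulr0.
by rewrite subr_ge0 leNgt lt_xa.
Qed.

Lemma hahn_geom m g : 0 < m -> supp_ge m g -> exists h, h * (1 - g) = 1.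
Proof.
move=> m0 gm.
have gX x n : x < m *+ n -> (g ^+ n) x = 0.
  move=> lt_x; apply/eqP; apply: contraTT lt_x => /(supp_geX gm).
  by rewrite -leNgt.
pose N x := Num.bound `|x / m|.
have NP x : x < m *+ N x.
  rewrite -mulr_natl -ltr_pdivrMr //; apply: le_lt_trans (ler_norm _) _.
  exact: archi_boundP (normr_ge0 _).
pose S n := \sum_(i < n) g ^+ i.
have SE x n k : x < m *+ n -> (n <= k)%N -> S k x = S n x.
  move=> lt_x; elim: k => [|k IHk]; first by rewrite leqn0 => /eqP->.
  rewrite leq_eqVlt => /predU1P[->//|le_nk].
  rewrite /S big_ord_recr hcoefD -/(S k) IHk // gX ?addr0 //.
  by apply: lt_le_trans lt_x _; apply: ler_wpMn2l => //; apply: ltW.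
have SS x n k : x < m *+ n -> x < m *+ k -> S k x = S n x.
  by move=> xn xk; rewrite -(SE _ _ (maxn n k) xn) ?leq_maxl //
    (SE _ _ (maxn n k) xk) ?leq_maxr.
have woh : well_ordered [set x | S (N x) x != 0].
  move=> B sB [x Bx].
  have [||y [By yx] ymin] := hahn_supp (S (N x)) (B `&` [set y | y <= x]).
  - move=> y [By /= yx]; have := sB _ By; rewrite /= (SS y (N x)) //.
    exact: le_lt_trans yx (NP x).
  - by exists x; split => /=.
  exists y => // v Bv; have [vx|/ltW xv] := leP v x; first exact: ymin.
  exact: le_trans xv.
exists (Hahn woh); apply/hahnP => x.
rewrite (@hcoefM_agree _ (S (N x))).
- rewrite mulrC -[_ * _]opprK -mulNr opprB /S -subrX1 opprB hcoefD hcoefN.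
  by rewrite gX // subr0.
- move=> y; rewrite hcoefD hcoefN hcoef1; case: (y =P 0) => [->//|_].
  by rewrite sub0r oppr_eq0 => /gm; apply: le_trans (ltW m0).
- by move=> y yx; apply: SS => //; apply: le_lt_trans yx _.
Qed.

Lemma hahn_inv_ex f : f != 0 -> exists g, g * f = 1.
Proof.
move=> /supp_min[m fm fmin].
pose u := hmonom (f m)^-1 (- m); pose g := 1 - u * f.
have gE x : g x = (if x == 0 then 1 else 0) - (f m)^-1 * f (x + m).
  by rewrite hcoefD hcoefN hcoef1 hcoef_monomM opprK.
have gpos x : g x != 0 -> 0 < x.
  rewrite gE; have [->|x0] := eqVneq x 0.
    by rewrite add0r mulVf // subrr eqxx.
  rewrite sub0r oppr_eq0 mulf_eq0 negb_or => /andP[_ /fmin].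
  by rewrite lerDr lt_neqAle eq_sym x0.
have [h hP] : exists h, h * (1 - g) = 1.
  have [g0|/supp_min[k gk kmin]] := eqVneq g 0.
    by exists 1; rewrite g0 subr0 mulr1.
  exact: hahn_geom (gpos _ gk) kmin.
by exists (h * u); rewrite -mulrA -hP /g subKr.
Qed.

Definition hahnV f : hahn := if f == 0 then 0 else xget 0 [set g | g * f = 1].

Fact hahnVM f : f != 0 -> hahnV f * f = 1.
Proof.
move=> f0; rewrite /hahnV (negPf f0).
by case: xgetP => [_ _ //|nex]; have [g /nex] := hahn_inv_ex f0.
Qed.

Fact hahnV0 : hahnV 0 = 0. Proof. by rewrite /hahnV eqxx. Qed.

End HahnField.

HB.instance Definition _ := GRing.ComNzRing_isField.Build hahn hahnVM hahnV0.

Definition hconst (c : algC) : hahn := hmonom c 0.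

Fact hconst_zmod : zmod_morphism hconst.
Proof.
by move=> c d; apply/hahnP => x /=; case: eqP => _; rewrite ?subr0.
Qed.
Fact hconst_monoid : monoid_morphism hconst.
Proof.
split=> // c d; apply/hahnP => x; rewrite hcoef_monomM /= subr0.
by case: eqP => _; rewrite ?mulr0.
Qed.
HB.instance Definition _ := GRing.isZmodMorphism.Build algC hahn hconst hconst_zmod.
HB.instance Definition _ :=
  GRing.isMonoidMorphism.Build algC hahn hconst hconst_monoid.

(* The union over k >= 1 of the fraction fields algC(z^(1/k)) inside hahn. *)
Definition in_Kinf (f : hahn) : Prop :=
  exists (k : nat) (P Q : {poly algC}), [/\ (0 < k)%N, Q != 0 &
    f = (map_poly hconst P).[hmonom 1 (k%:R^-1)]
        / (map_poly hconst Q).[hmonom 1 (k%:R^-1)]].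

Definition in_puiseux (f : hahn) : Prop :=
  exists (k : nat) (m : int), (0 < k)%N /\
    forall x, f x != 0 -> exists2 n : int, m <= n & x = n%:~R / k%:R.

Definition nzC : Type := {c : algC | c != 0}.
Definition posQ : Type := {q : rat | 0 < q}.
HB.instance Definition _ := Choice.on nzC.
HB.instance Definition _ := Choice.on posQ.

Definition Lambda_ (t : nat) : Type :=
  (t.-tuple nat * t.-tuple nzC * t.-tuple posQ)%type.
Definition Lambda : Type := {t : nat & Lambda_ t}.
HB.instance Definition _ t := Choice.on (Lambda_ t).
HB.instance Definition _ := Choice.on Lambda.

Lemma well_ordered_bigsum (I : Type) (r : seq I) (A : I -> set rat) :
  (forall i, well_ordered (A i)) ->
  well_ordered [set x | exists2 F : I -> rat,
    (forall i, A i (F i)) & x = \sum_(i <- r) F i].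
Proof.
move=> woA; elim: r => [|i r IHr].
  by apply: (well_orderedS _ (@well_ordered1 0)) => x [F _ ->]; rewrite big_nil.
apply: well_orderedS (well_ordered_sumset (woA i) IHr) => x [F AF ->].
by exists (F i), (\sum_(j <- r) F j); split=> //; [exists F | rewrite big_cons].
Qed.

Lemma finite_bigsum_fiber (I : Type) (r : seq I) (A : I -> set rat) x :
  (forall i, well_ordered (A i)) ->
  finite_set [set s | exists F : I -> rat, [/\ forall i, A i (F i),
    \sum_(i <- r) F i = x & s = [seq F i | i <- r]]].
Proof.
move=> woA; elim: r x => [|i r IHr] x.
  by apply: sub_finite_set (finite_set1 [::]) => s [F [_ _ ->]].
have := finite_sum_fiber x (woA i) (@well_ordered_bigsum _ r A woA).
move=> /bigcup_finite /(_ (fun a _ => finite_image (cons a) (IHr (x - a)))).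
apply: sub_finite_set => s [F [AF xE ->]]; rewrite big_cons in xE.
have xE' : \sum_(j <- r) F j = x - F i by rewrite -xE addrC addKr.
exists (F i); first by split=> //; exists F.
by exists [seq F j | j <- r] => //; exists F.
Qed.

Section Mahler.
Variables (p : nat) (p_gt1 : (1 < p)%N).

Let p_gt0 : 0 < p%:R :> rat. Proof. by rewrite ltr0n ltnW. Qed.
Let p_neq0 : p%:R != 0 :> rat. Proof. by rewrite gt_eqF. Qed.

Fact phi_subproof (f : hahn) : well_ordered [set x | f (x / p%:R) != 0].
Proof.
move=> B sB [b Bb].
have [||m Bm mmin] := hahn_supp f ([set x | B (x * p%:R)]).
- by move=> x /= /sB /=; rewrite mulfK.
- by exists (b / p%:R); rewrite /= divfK.
exists (m * p%:R) => // x Bx; rewrite -ler_pdivlMr //.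
by apply: mmin; rewrite /= divfK.
Qed.
Definition phi (f : hahn) : hahn := Hahn (@phi_subproof f).

Fact phi_zmod : zmod_morphism phi.
Proof. by move=> f g; apply/hahnP. Qed.
Fact phi_monoid : monoid_morphism phi.
Proof.
split=> [|f g]; apply/hahnP => x.
  by rewrite /= mulf_eq0 invr_eq0 (negPf p_neq0) orbF.
rewrite [LHS]hcoefM hcoefM (@reindex_fsbigT _ _ _ _ _ (fun y => y / p%:R)).
  by apply: eq_fsbigr => a _; rewrite /= mulrBl.
by exists (fun y => y * p%:R) => y; rewrite ?divfK ?mulfK.
Qed.
HB.instance Definition _ := GRing.isZmodMorphism.Build hahn hahn phi phi_zmod.
HB.instance Definition _ := GRing.isMonoidMorphism.Build hahn hahn phi phi_monoid.

Lemma phi_bij : bijective phi.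
Proof.
have wo (f : hahn) : well_ordered [set x | f (x * p%:R) != 0].
  move=> B sB [b Bb].
  have [||m Bm mmin] := hahn_supp f ([set x | B (x / p%:R)]).
  - by move=> x /= /sB /=; rewrite divfK.
  - by exists (b * p%:R); rewrite /= mulfK.
  exists (m / p%:R) => // x Bx; rewrite ler_pdivrMr //.
  by apply: mmin; rewrite /= mulfK.
by exists (fun f => Hahn (wo f)) => f; apply/hahnP => x /=;
  rewrite ?divfK ?mulfK.
Qed.

Definition mahler_coefs (d : nat) (a : 'I_d.+1 -> hahn) : Prop :=
  (forall i, in_Kinf (a i)) /\ a ord0 * a ord_max != 0.

Definition mahler_puiseux (f : hahn) : Prop :=
  in_puiseux f /\
  exists (d : nat) (a : 'I_d.+1 -> hahn), mahler_coefs a /\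
    \sum_(i < d.+1) a i * iter i phi f = 0.


Lemma mahler_puiseux0 : mahler_puiseux 0.
Proof.
split; first by exists 1%N, 0; split=> // x; rewrite hcoef0 eqxx.
exists 0%N, (fun=> 1); split; last first.
  by rewrite big_ord1 mul1r.
split=> [_|]; last by rewrite mulr1 oner_neq0.
exists 1%N, 1, 1; split=> //; first exact: oner_neq0.
by rewrite rmorph1 hornerC divr1.
Qed.

Section Xi.
Variables (t : nat) (w : Lambda_ t).
Let alpha i : nat := tnth w.1.1 i.
Let lambda i : algC := sval (tnth w.1.2 i).
Let a i : rat := sval (tnth w.2 i).

(* k_1 + ... + k_i *)
Definition psum (k : t.-tuple nat) (i : 'I_t) : nat :=
  (\sum_(j < t | (j <= i)%N) tnth k j)%N.

Definition xi_expo (k : t.-tuple nat) : rat :=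
  \sum_(i < t) - (a i / p%:R ^+ psum k i).

Definition xi_term (k : t.-tuple nat) : algC :=
  \prod_(i < t) (tnth k i)%:R ^+ alpha i * \prod_(i < t) lambda i ^+ psum k i.

Definition xi_index (x : rat) : set (t.-tuple nat) :=
  [set k | (forall i, (1 <= tnth k i)%N) /\ xi_expo k = x].

(* The index set is finite, by finite_xi_index. *)
Definition xi_coef (x : rat) : algC := \sum_(k \in xi_index x) xi_term k.

Let E (i : 'I_t) : set rat :=
  [set x | exists n : nat, x = - (a i / p%:R ^+ n)].

Let a_gt0 i : 0 < a i. Proof. exact: (svalP (tnth w.2 i)). Qed.

Let woE i : well_ordered (E i).
Proof.
move=> B sB [x Bx].
have Pex : exists n, `[< B (- (a i / p%:R ^+ n)) >].
  by have [n xE] := sB _ Bx; exists n; apply/asboolP; rewrite -xE.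
case: (ex_minnP Pex) => n /asboolP Bn nmin.
exists (- (a i / p%:R ^+ n)) => // y By; have [k yE] := sB _ By.
rewrite yE lerN2 ler_pM2l // lef_pV2 ?posrE ?exprn_gt0 //.
rewrite ler_weXn2l ?ler1n ?(ltnW p_gt1) //.
by apply: nmin; apply/asboolP; rewrite -yE.
Qed.

Lemma psum_inj (k l : t.-tuple nat) : psum k =1 psum l -> k = l.
Proof.
move=> kl; apply: eq_from_tnth => i.
have [n] := ubnP (i : nat); elim: n i => // n IHn i lt_in.
have := kl i; rewrite /psum (bigD1 i) //= [in RHS](bigD1 i) //=.
rewrite (eq_bigr (fun j => tnth l j)); first by move/addIn.
move=> j /andP[le_ji neq_ji]; apply: IHn.
by apply: leq_trans (_ : (i <= n)%N) => //; rewrite ltn_neqAle neq_ji.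
Qed.

Lemma finite_xi_index x : finite_set (xi_index x).
Proof.
pose F (k : t.-tuple nat) := [seq - (a i / p%:R ^+ psum k i) | i <- index_enum 'I_t].
have fin := finite_bigsum_fiber (index_enum 'I_t) x woE.
have Finj : injective F.
  move=> k l /eq_in_map kl; apply: psum_inj => i.
  have /eqP := kl i (mem_index_enum i).
  rewrite eqr_opp (inj_eq (mulfI (lt0r_neq0 (a_gt0 i)))) (inj_eq invr_inj).
  by move=> /eqP/ieexprIn; apply => //; rewrite pnatr_eq1 gtn_eqF.
apply: (@sub_finite_set _ _ (F @^-1` _)); last first.
  by apply: (finite_preimage _ fin) => k l _ _ /Finj.
move=> k [_ kx]; exists (fun i => - (a i / p%:R ^+ psum k i)); split=> //.
by move=> i; exists (psum k i).
Qed.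

Fact xi_subproof : well_ordered [set x | xi_coef x != 0].
Proof.
apply: well_orderedS (@well_ordered_bigsum _ (index_enum 'I_t) E woE) => x /= x0.
have [k [_ kx]] : xi_index x !=set0.
  apply: contrapT => nex; case/eqP: x0; rewrite /xi_coef.
  by apply: fsbig1 => k ik; case: nex; exists k.
exists (fun i => - (a i / p%:R ^+ psum k i)) => [i|]; first by exists (psum k i).
by rewrite -kx.
Qed.

Definition xi_ : hahn := Hahn xi_subproof.

End Xi.

Definition xi (w : Lambda) : hahn := xi_ (projT2 w).

Lemma xi0 (w : Lambda_ 0) : xi_ w = 1.
Proof.
apply/hahnP => x; rewrite hcoef1 /= /xi_coef.
have expo0 k : xi_expo w k = 0 by rewrite /xi_expo big_ord0.
have [->|x0] := eqVneq x 0.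
  have -> : xi_index w 0 = [set [tuple]].
    apply/seteqP; split=> k /=; first by rewrite [k]tuple0.
    by move=> ->; split=> //; case.
  by rewrite fsbig_set1 /xi_term !big_ord0 mulr1.
apply: fsbig1 => k [_]; rewrite expo0 => xE.
by rewrite -xE eqxx in x0.
Qed.

Definition gen_mahler (R : comNzRingType) (iota : hahn -> R)
    (ell : R) (e : nzC -> R) (y : R) : Prop :=
  exists F : nzC * nat * Lambda -> hahn,
    [/\ finite_set [set i | F i != 0],
        forall i, mahler_puiseux (F i)
      & y = \sum_(i \in setT)
              iota (F i) * iota (xi i.2) * e i.1.1 * ell ^+ i.1.2].

End Mahler.

Arguments mahler_puiseux {p} p_gt1 f.
Arguments xi {p} p_gt1 w.
Arguments gen_mahler {p} p_gt1 {R} iota ell e y.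

(* Main.v *)
Require Import Defs.
From HB Require Import structures.
From mathcomp Require Import all_boot all_order all_algebra all_field.
From mathcomp Require Import finmap all_classical.
From mathcomp Require Import monalg zify ring.

Set Implicit Arguments.
Unset Strict Implicit.
Unset Printing Implicit Defensive.

Import Order.TTheory GRing.Theory Num.Theory.
Local Open Scope classical_set_scope.
Local Open Scope ring_scope.

(* Over Puiseux series, a Mahler operator L of order d >= 1 has a solution
   e_c f with f a nonzero Puiseux series: take f of valuation the largest slope
   of the Newton polygon, beyond which the coefficient of phi^0 dominates, so
   that the tail of f solves a contracting fixed point equation. Replacing the
   unknown by f w, L becomes Q (phi - c), and one concludes by induction on d
   once phi w - c w = u is solvable inside the span of the e_c ell^j xi_omega
   over Puiseux series. It is, because phi acts triangularly on these symbols: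

     phi xi_(alpha, lambda, a) = lambda_1 ... lambda_t *
       (z^(-a_1) xi_(tails) + sum_(b <= alpha_1) C(alpha_1, b) xi_(alpha_1 := b)).

   The symbols may be linearly dependent in R, so the equations are solved in
   the free module they generate. There the coefficients of a solution are well
   defined and, phi being triangular with entries in K_inf, reverse induction
   shows that each of them lies in a finite-dimensional phi-stable K_inf-space,
   i.e. is p-Mahler. *)

(** * Action of [phi] on monomials and constants *)

Section Phi.
Variables (p : nat) (p_gt1 : (1 < p)%N).
Local Notation phi := (phi p_gt1).
Implicit Types f g h : hahn.

Lemma ltr0p : 0 < p%:R :> rat. Proof. by rewrite ltr0n ltnW. Qed.
Lemma pnatr_neq0 : p%:R != 0 :> rat. Proof. by rewrite gt_eqF ?ltr0p. Qed.
Lemma ltr0pX n : 0 < p%:R ^+ n :> rat. Proof. by rewrite exprn_gt0 ?ltr0p. Qed.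

Lemma hcoef_phi f x : phi f x = f (x / p%:R). Proof. by []. Qed.

Lemma hcoef_iter_phi i f x : iter i phi f x = f (x / p%:R ^+ i).
Proof.
elim: i x => [|i IHi] x; first by rewrite expr0 divr1.
by rewrite iterS hcoef_phi IHi exprS invfM mulrA.
Qed.

Lemma iter_phi_monoid i : monoid_morphism (iter i phi).
Proof.
split; elim: i => // i IHi; first by rewrite iterS IHi rmorph1.
by move=> f g; rewrite !iterS IHi rmorphM.
Qed.

Lemma iter_phiM i : {morph iter i phi : f g / f * g}.
Proof. by case: (iter_phi_monoid i). Qed.

Lemma iter_phiD i : {morph iter i phi : f g / f + g}.
Proof. by move=> f g; elim: i => // i IHi; rewrite !iterS IHi rmorphD. Qed.

Lemma iter_phi1 i : iter i phi 1 = 1.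
Proof. by case: (iter_phi_monoid i). Qed.

Lemma hmonomM c d q r : hmonom c q * hmonom d r = hmonom (c * d) (q + r).
Proof.
apply/hahnP => x; rewrite hcoef_monomM /= subr_eq addrC.
by case: eqP => _ //; rewrite mulr0.
Qed.

Lemma hmonomX c q n : hmonom c q ^+ n = hmonom (c ^+ n) (q *+ n).
Proof. by elim: n => // n IHn; rewrite !exprS IHn hmonomM mulrS. Qed.

Lemma hmonom_eq0 c q : (hmonom c q == 0) = (c == 0).
Proof.
apply/eqP/eqP => [/hahnP/(_ q)|->]; first by rewrite /= eqxx.
by apply/hahnP => x /=; rewrite if_same.
Qed.

Lemma hmonomV q : (hmonom 1 q)^-1 = hmonom 1 (- q).
Proof.
apply: (mulfI (_ : hmonom 1 q != 0)); first by rewrite hmonom_eq0 oner_eq0.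
by rewrite hmonomM subrr mulr1 mulfV // hmonom_eq0 oner_eq0.
Qed.

Lemma phi_monom c q : phi (hmonom c q) = hmonom c (p%:R * q).
Proof.
apply/hahnP => x /=; congr (if _ then _ else _).
by rewrite -(inj_eq (mulIf pnatr_neq0)) divfK ?pnatr_neq0 // (mulrC q).
Qed.

Lemma iter_phi_monom i c q : iter i phi (hmonom c q) = hmonom c (p%:R ^+ i * q).
Proof.
elim: i => [|i IHi]; first by rewrite mul1r.
by rewrite iterS IHi phi_monom mulrA exprS.
Qed.

Lemma phi_const c : phi (hconst c) = hconst c.
Proof. by rewrite phi_monom mulr0. Qed.

Lemma hconst_eq0 c : (hconst c == 0) = (c == 0).
Proof. exact: hmonom_eq0. Qed.

Lemma hcoef_constM c f x : (hconst c * f) x = c * f x.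
Proof. by rewrite hcoef_monomM subr0. Qed.

Lemma phi_inj : injective phi.
Proof. exact: bij_inj (phi_bij p_gt1). Qed.

Lemma phi_eq0 f : (phi f == 0) = (f == 0).
Proof. exact: fmorph_eq0. Qed.

(** * Puiseux series as Hahn series supported on a grid (1/k)Z *)

Definition grid (k : nat) : {pred rat} := [pred x | x * k%:R \is a Num.int].

Lemma gridE k x : (x \in grid k) = (x * k%:R \is a Num.int). Proof. by []. Qed.

Definition on_grid (k : nat) f := forall x, f x != 0 -> x \in grid k.

Lemma gridD k x y : x \in grid k -> y \in grid k -> x + y \in grid k.
Proof. by rewrite !gridE mulrDl; apply: rpredD. Qed.

Lemma gridN k x : x \in grid k -> - x \in grid k.
Proof. by rewrite !gridE mulNr rpredN. Qed.

Lemma gridMn k l x : x \in grid k -> x \in grid (k * l).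
Proof. by rewrite !gridE natrM mulrA => xk; rewrite rpredM // natr_int. Qed.

(** The support of a nonzero Hahn series has a least element, so the lower bound in [in_puiseux]
    comes for free and only a common denominator is at stake. *)
Lemma in_puiseuxP f :
  in_puiseux f <-> exists2 k : nat, (0 < k)%N & on_grid k f.
Proof.
split=> [[k [m [k0 fk]]]|[k k0 fk]].
  exists k => // x /fk[n _ ->]; rewrite gridE divfK ?intr_int //.
  by rewrite pnatr_eq0 -lt0n.
have kr0 : k%:R != 0 :> rat by rewrite pnatr_eq0 -lt0n.
have [->|/supp_min[m fm mmin]] := eqVneq f 0.
  by exists 1%N, 0; split=> // x; rewrite hcoef0 eqxx.
have /intrP[n nE] := fk _ fm.
exists k, n; split=> // x fx; have /intrP[n' n'E] := fk _ fx.
exists n'; last by rewrite -n'E mulfK.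
by rewrite -(ler_int rat) -nE -n'E ler_pM2r ?mmin // ltr0n.
Qed.

Lemma on_gridMn k l f : on_grid k f -> on_grid (k * l) f.
Proof. by move=> fk x /fk; apply: gridMn. Qed.

Lemma on_grid0 k : on_grid k 0.
Proof. by move=> x; rewrite hcoef0 eqxx. Qed.

Lemma on_gridD k f g : on_grid k f -> on_grid k g -> on_grid k (f + g).
Proof.
move=> fk gk x; rewrite hcoefD.
by have [->|/fk //] := eqVneq (f x) 0; rewrite add0r => /gk.
Qed.

Lemma on_gridN k f : on_grid k f -> on_grid k (- f).
Proof. by move=> fk x; rewrite hcoefN oppr_eq0 => /fk. Qed.

Lemma on_gridM k f g : on_grid k f -> on_grid k g -> on_grid k (f * g).
Proof.
by move=> fk gk x /hmul_coef_supp[y [w [/fk ? /gk ? ->]]]; apply: gridD.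
Qed.

Lemma on_grid_phi k f : on_grid k f -> on_grid k (phi f).
Proof.
move=> fk x; rewrite hcoef_phi => /fk; rewrite !gridE => /(rpredM (natr_int _ p)).
by rewrite mulrA mulrCA mulfV ?pnatr_neq0 // mulr1.
Qed.

Lemma on_grid_monom k c q : q \in grid k -> on_grid k (hmonom c q).
Proof. by move=> qk x /=; case: (x =P q) => [->//|_]; rewrite eqxx. Qed.

Lemma on_grid_sum k I (r : seq I) (P : pred I) (F : I -> hahn) :
  (forall i, P i -> on_grid k (F i)) -> on_grid k (\sum_(i <- r | P i) F i).
Proof. by move=> Fk; elim/big_ind: _ => //; [apply: on_grid0|apply: on_gridD]. Qed.

Fact grid_part_subproof k f :
  well_ordered [set x | (if x \in grid k then f x else 0) != 0].
Proof.
by apply: well_orderedS (hahn_supp f) => x /=; case: ifP => //; rewrite eqxx.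
Qed.
Definition grid_part k f : hahn := Hahn (@grid_part_subproof k f).

(* The part of [f^-1] supported on the grid is already an inverse of [f]. *)
Lemma on_gridV k f : on_grid k f -> on_grid k f^-1.
Proof.
move=> fk; have [->|f0] := eqVneq f 0; first by rewrite invr0; apply: on_grid0.
suff <- : grid_part k f^-1 = f^-1.
  by move=> x /=; case: ifP => // _; rewrite eqxx.
apply: (mulfI f0); rewrite mulfV //; apply/hahnP => x.
rewrite hcoefM; transitivity (if x \in grid k then (f * f^-1) x else 0).
  case: ifPn => xk.
    rewrite hcoefM; apply: eq_fsbigr => y _ /=.
    have [->|/fk yk] := eqVneq (f y) 0; first by rewrite !mul0r.
    by rewrite gridD ?gridN.
  apply: fsbig1 => y _ /=; have [->|/fk yk] := eqVneq (f y) 0.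
    by rewrite mul0r.
  case: ifP => [xyk|_]; last by rewrite mulr0.
  by case/negP: xk; rewrite -(subrK y x) gridD.
rewrite mulfV // hcoef1; case: eqP => [->|_]; last by rewrite if_same.
by rewrite gridE mul0r rpred0.
Qed.

Lemma in_puiseux0 : in_puiseux 0.
Proof. by apply/in_puiseuxP; exists 1%N => //; apply: on_grid0. Qed.

Lemma in_puiseuxD f g : in_puiseux f -> in_puiseux g -> in_puiseux (f + g).
Proof.
move=> /in_puiseuxP[k k0 fk] /in_puiseuxP[l l0 gl]; apply/in_puiseuxP.
exists (k * l)%N; first by rewrite muln_gt0 k0.
by apply: on_gridD; [|rewrite mulnC]; apply: on_gridMn.
Qed.

Lemma in_puiseuxM f g : in_puiseux f -> in_puiseux g -> in_puiseux (f * g).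
Proof.
move=> /in_puiseuxP[k k0 fk] /in_puiseuxP[l l0 gl]; apply/in_puiseuxP.
exists (k * l)%N; first by rewrite muln_gt0 k0.
by apply: on_gridM; [|rewrite mulnC]; apply: on_gridMn.
Qed.

Lemma in_puiseuxN f : in_puiseux f -> in_puiseux (- f).
Proof.
by move=> /in_puiseuxP[k k0 fk]; apply/in_puiseuxP; exists k => //; apply: on_gridN.
Qed.

Lemma in_puiseuxV f : in_puiseux f -> in_puiseux f^-1.
Proof.
by move=> /in_puiseuxP[k k0 fk]; apply/in_puiseuxP; exists k => //; apply: on_gridV.
Qed.

Lemma in_puiseux_phi f : in_puiseux f -> in_puiseux (phi f).
Proof.
by move=> /in_puiseuxP[k k0 fk]; apply/in_puiseuxP; exists k => //; apply: on_grid_phi.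
Qed.

Lemma in_puiseux_monom c q : in_puiseux (hmonom c q).
Proof.
apply/in_puiseuxP; exists `|denq q|%N; first by rewrite absz_gt0 denq_neq0.
apply: on_grid_monom; rewrite gridE -[X in X * _]divq_num_den.
by rewrite natr_absz gtr0_norm ?denq_gt0 // divfK ?intr_int // intr_eq0 denq_neq0.
Qed.

Lemma in_puiseux_const c : in_puiseux (hconst c).
Proof. exact: in_puiseux_monom. Qed.

Lemma in_puiseux_sum I (r : seq I) (P : pred I) (F : I -> hahn) :
  (forall i, P i -> in_puiseux (F i)) -> in_puiseux (\sum_(i <- r | P i) F i).
Proof.
by move=> Fk; elim/big_ind: _ => //; [apply: in_puiseux0|apply: in_puiseuxD].
Qed.

Lemma common_grid n (F : nat -> hahn) :
  (forall i, (i < n)%N -> in_puiseux (F i)) ->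
  exists2 k, (0 < k)%N & forall i, (i < n)%N -> on_grid k (F i).
Proof.
elim: n => [|n IHn] FP; first by exists 1%N.
have [i ltin|k k0 Fk] := IHn; first by apply: FP; apply: ltnW.
have /in_puiseuxP[l l0 Fl] := FP n (ltnSn n).
exists (k * l)%N => [|i]; first by rewrite muln_gt0 k0.
rewrite ltnS leq_eqVlt => /predU1P[->|ltin]; last exact/on_gridMn/Fk.
by rewrite mulnC; apply: on_gridMn.
Qed.

(** * The field K_inf *)

Definition hroot_eval (k : nat) (P : {poly algC}) : hahn :=
  (map_poly hconst P).[hmonom 1 (k%:R^-1)].

Lemma hroot_evalE k P :
  hroot_eval k P = \sum_(i < size P) hmonom P`_i (i%:R / k%:R).
Proof.
rewrite /hroot_eval horner_coef size_map_poly; apply: eq_bigr => i _.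
by rewrite coef_map hmonomX hmonomM expr1n mulr1 add0r mulr_natl.
Qed.

Lemma hroot_eval_coef k P n : (0 < k)%N -> hroot_eval k P (n%:R / k%:R) = P`_n.
Proof.
move=> k0; have kV0 : k%:R^-1 != 0 :> rat by rewrite invr_eq0 pnatr_eq0 -lt0n.
have eqk i : (n%:R / k%:R == i%:R / k%:R :> rat) = (n == i).
  by rewrite (inj_eq (mulIf kV0)) eqr_nat.
rewrite hroot_evalE hcoef_sum /=.
have [ltnP|leP] := ltnP n (size P); last first.
  rewrite nth_default // big1 // => i _; rewrite eqk gtn_eqF //.
  exact: leq_trans leP.
rewrite (bigD1 (Ordinal ltnP)) //= eqxx big1 ?addr0 // => i; rewrite -val_eqE /=.
by rewrite eqk eq_sym => /negPf ->.
Qed.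

Lemma hroot_eval_eq0 k P : (0 < k)%N -> (hroot_eval k P == 0) = (P == 0).
Proof.
move=> k0; apply/eqP/eqP => [P0|->]; last by rewrite hroot_evalE size_poly0 big_ord0.
by apply/polyP => i; rewrite -(hroot_eval_coef P i k0) P0 coef0.
Qed.

Lemma hroot_evalM k P Q : hroot_eval k (P * Q) = hroot_eval k P * hroot_eval k Q.
Proof. by rewrite /hroot_eval rmorphM hornerM. Qed.

Lemma hroot_evalD k P Q : hroot_eval k (P + Q) = hroot_eval k P + hroot_eval k Q.
Proof. by rewrite /hroot_eval rmorphD hornerD. Qed.

(** As [z^(1/k)] is the [l]-th power of [z^(1/(kl))], the root can be refined; this gives two
    elements of K_inf a common [k]. *)
Lemma hroot_eval_scale k l P : (0 < l)%N ->
  hroot_eval (k * l) (P \Po 'X^l) = hroot_eval k P.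
Proof.
move=> l0; rewrite /hroot_eval map_comp_poly map_polyXn horner_comp hornerXn.
rewrite hmonomX expr1n natrM invfM -[_ *+ l]mulr_natr divfK //.
by rewrite pnatr_eq0 -lt0n.
Qed.

Lemma hroot_eval_phi k P : phi (hroot_eval k P) = hroot_eval k (P \Po 'X^p).
Proof.
rewrite /hroot_eval map_comp_poly map_polyXn horner_comp hornerXn hmonomX expr1n.
rewrite !horner_coef rmorph_sum; apply: eq_bigr => i _.
by rewrite rmorphM coef_map /= phi_const rmorphXn /= phi_monom mulr_natl.
Qed.

Lemma hroot_eval_phiV k P :
  phi (hroot_eval (p * k) P) = hroot_eval k P.
Proof.
rewrite /hroot_eval !horner_coef rmorph_sum; apply: eq_bigr => i _.
rewrite rmorphM coef_map /= phi_const rmorphXn /= phi_monom.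
by rewrite natrM invfM mulrA mulfV ?mul1r // pnatr_neq0.
Qed.

Lemma comp_polyXn_eq0 l (P : {poly algC}) : (0 < l)%N -> (P \Po 'X^l == 0) = (P == 0).
Proof.
move=> l0.
have := hroot_eval_scale 1 P l0; rewrite mul1n => scaleE.
by rewrite -(hroot_eval_eq0 (P \Po 'X^l) l0) scaleE hroot_eval_eq0.
Qed.

Lemma in_KinfP f : in_Kinf f <-> exists k P Q,
  [/\ (0 < k)%N, Q != 0 & f = hroot_eval k P / hroot_eval k Q].
Proof. by []. Qed.

Lemma in_Kinf_common f g : in_Kinf f -> in_Kinf g ->
  exists k P Q P' Q', [/\ (0 < k)%N, Q != 0, Q' != 0,
    f = hroot_eval k P / hroot_eval k Q & g = hroot_eval k P' / hroot_eval k Q'].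
Proof.
move=> /in_KinfP[k [P [Q [k0 Q0 ->]]]] /in_KinfP[l [P' [Q' [l0 Q'0 ->]]]].
exists (k * l)%N, (P \Po 'X^l), (Q \Po 'X^l), (P' \Po 'X^k), (Q' \Po 'X^k).
rewrite muln_gt0 k0 l0 !comp_polyXn_eq0 //.
by split=> //; [|rewrite mulnC]; rewrite !hroot_eval_scale.
Qed.

Lemma in_KinfD f g : in_Kinf f -> in_Kinf g -> in_Kinf (f + g).
Proof.
move=> fK /(in_Kinf_common fK)[k [P [Q [P' [Q' [k0 Q0 Q'0 -> ->]]]]]].
apply/in_KinfP; exists k, (P * Q' + P' * Q), (Q * Q'); split=> //.
  by rewrite mulf_neq0.
by rewrite hroot_evalD !hroot_evalM addf_div // hroot_eval_eq0.
Qed.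

Lemma in_KinfM f g : in_Kinf f -> in_Kinf g -> in_Kinf (f * g).
Proof.
move=> fK /(in_Kinf_common fK)[k [P [Q [P' [Q' [k0 Q0 Q'0 -> ->]]]]]].
apply/in_KinfP; exists k, (P * P'), (Q * Q'); split=> //.
  by rewrite mulf_neq0.
by rewrite !hroot_evalM mulf_div.
Qed.

Lemma in_Kinf_const c : in_Kinf (hconst c).
Proof.
exists 1%N, c%:P, 1; split; rewrite ?oner_neq0 //.
by rewrite map_polyC hornerC rmorph1 hornerC divr1.
Qed.

Lemma in_Kinf0 : in_Kinf 0.
Proof. by rewrite -(rmorph0 hconst); apply: in_Kinf_const. Qed.

Lemma in_Kinf1 : in_Kinf 1.
Proof. exact: in_Kinf_const 1. Qed.

Lemma in_KinfN f : in_Kinf f -> in_Kinf (- f).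
Proof.
move=> fK; rewrite -mulN1r; apply: in_KinfM => //.
by rewrite -(rmorphN1 hconst); apply: in_Kinf_const.
Qed.

Lemma in_KinfV f : in_Kinf f -> in_Kinf f^-1.
Proof.
move=> /in_KinfP[k [P [Q [k0 Q0 ->]]]]; have [->|P0] := eqVneq P 0.
  have /eqP -> : hroot_eval k 0 == 0 by rewrite hroot_eval_eq0.
  by rewrite mul0r invr0; apply: in_Kinf0.
by apply/in_KinfP; exists k, Q, P; split=> //; rewrite invf_div.
Qed.

Lemma in_Kinf_phi f : in_Kinf f -> in_Kinf (phi f).
Proof.
move=> /in_KinfP[k [P [Q [k0 Q0 ->]]]]; apply/in_KinfP.
exists k, (P \Po 'X^p), (Q \Po 'X^p); rewrite comp_polyXn_eq0 ?(ltnW p_gt1) //.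
by split=> //; rewrite fmorph_div /= !hroot_eval_phi.
Qed.

(** As [z^(1/k)] is the image of [z^(1/(pk))] under [phi], taking a further root inverts [phi]. *)
Lemma in_Kinf_phiV f : in_Kinf f -> exists2 g, in_Kinf g & phi g = f.
Proof.
move=> /in_KinfP[k [P [Q [k0 Q0 ->]]]].
exists (hroot_eval (p * k) P / hroot_eval (p * k) Q); last first.
  by rewrite fmorph_div /= !hroot_eval_phiV.
by apply/in_KinfP; exists (p * k)%N, P, Q; rewrite muln_gt0 k0 ltnW.
Qed.

Lemma in_Kinf_sum I (r : seq I) (P : pred I) (F : I -> hahn) :
  (forall i, P i -> in_Kinf (F i)) -> in_Kinf (\sum_(i <- r | P i) F i).
Proof.
by move=> Fk; elim/big_ind: _ => //; [apply: in_Kinf0|apply: in_KinfD].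
Qed.

Lemma in_Kinf_monomN c (q : rat) : 0 < q -> in_Kinf (hmonom c (- q)).
Proof.
move=> q0; have -> : hmonom c (- q) = hconst c * (hmonom 1 q)^-1.
  by rewrite hmonomV hmonomM mulr1 add0r.
apply: in_KinfM; first exact: in_Kinf_const.
apply: in_KinfV; apply/in_KinfP; exists `|denq q|%N, 'X^`|numq q|, 1.
split; rewrite ?oner_neq0 ?absz_gt0 ?denq_neq0 //.
rewrite /hroot_eval rmorph1 hornerC divr1 map_polyXn hornerXn hmonomX expr1n.
congr hmonom; rewrite -[_ *+ `|numq q|]mulr_natl !natr_absz.
by rewrite (gtr0_norm (denq_gt0 q)) gtr0_norm ?divq_num_den ?numq_gt0.
Qed.

Lemma in_puiseux_Kinf f : in_Kinf f -> in_puiseux f.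
Proof.
have evP k P : in_puiseux (hroot_eval k P).
  by rewrite hroot_evalE; apply: in_puiseux_sum => i _; apply: in_puiseux_monom.
move=> /in_KinfP[k [P [Q [_ _ ->]]]].
by apply: in_puiseuxM => //; apply: in_puiseuxV.
Qed.

End Phi.

(** * Valuation bounds and limits *)

Lemma supp_geD m (f g : hahn) : supp_ge m f -> supp_ge m g -> supp_ge m (f + g).
Proof.
move=> fm gm x; rewrite hcoefD.
by have [->|/fm //] := eqVneq (f x) 0; rewrite add0r => /gm.
Qed.

Lemma supp_geN m (f : hahn) : supp_ge m f -> supp_ge m (- f).
Proof. by move=> fm x; rewrite hcoefN oppr_eq0 => /fm. Qed.

Lemma supp_ge_sum m I (r : seq I) (P : pred I) (F : I -> hahn) :
  (forall i, P i -> supp_ge m (F i)) -> supp_ge m (\sum_(i <- r | P i) F i).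
Proof.
move=> Fm; elim/big_ind: _ => //; last exact: supp_geD.
by move=> x; rewrite hcoef0 eqxx.
Qed.

Lemma supp_ge_trans m n (f : hahn) : n <= m -> supp_ge m f -> supp_ge n f.
Proof. by move=> nm fm x /fm; apply: le_trans. Qed.

Lemma supp_ge_monomM m c q (f : hahn) : supp_ge m f -> supp_ge (q + m) (hmonom c q * f).
Proof.
by apply: supp_geM => x /=; case: (x =P q) => [->|]; rewrite ?eqxx.
Qed.

(** The coefficients of [s n] at exponents below [(n+1)e] are final, so the limit takes its
    coefficient at [x] from an index [N x] with [x < (N x + 1)e]. Up to [x] it agrees with the
    single series [s (N x)], hence its support is well ordered. *)
Lemma supp_ge_lim (s : nat -> hahn) (e : rat) : 0 < e ->
  (forall n, supp_ge (e *+ n.+1) (s n.+1 - s n)) ->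
  exists h : hahn, forall n, supp_ge (e *+ n.+1) (h - s n).
Proof.
move=> e0 sP.
have sE n k x : x < e *+ n.+1 -> (n <= k)%N -> s k x = s n x.
  move=> xn; elim: k => [|k IHk]; first by rewrite leqn0 => /eqP->.
  rewrite leq_eqVlt => /predU1P[->//|]; rewrite ltnS => nk.
  rewrite -IHk //; apply/eqP; rewrite -subr_eq0 -hcoefN -hcoefD.
  apply/negPn/negP => /sP; apply/negP; rewrite -ltNge.
  by apply: lt_le_trans xn _; apply: ler_wpMn2l => //; apply: ltW.
pose N x := Num.bound `|x / e|.
have NP x : x < e *+ (N x).+1.
  rewrite -[e *+ _]mulr_natl -ltr_pdivrMr //; apply: le_lt_trans (ler_norm _) _.
  by apply: lt_trans (archi_boundP (normr_ge0 _)) _; rewrite ltr_nat.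
have sN n x : x < e *+ n.+1 -> s (N x) x = s n x.
  move=> xn; rewrite -(sE _ (maxn n (N x)) _ xn) ?leq_maxl //.
  by rewrite (sE _ (maxn n (N x)) _ (NP x)) ?leq_maxr.
have woh : well_ordered [set x | s (N x) x != 0].
  move=> B sB [x Bx].
  have [||y [By yx] ymin] := hahn_supp (s (N x)) (B `&` [set y | y <= x]).
  - move=> y [By /= yx]; have := sB _ By; rewrite /= (sN (N x)) //.
    exact: le_lt_trans yx (NP x).
  - by exists x; split => /=.
  exists y => // v Bv; have [vx|/ltW xv] := leP v x; first exact: ymin.
  exact: le_trans xv.
exists (Hahn woh) => n x; rewrite hcoefD hcoefN /= leNgt; apply: contra => xn.
by rewrite (sN n) // subrr.
Qed.

Lemma supp_ge_all0 (e : rat) (f : hahn) : 0 < e ->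
  (forall n, supp_ge (e *+ n.+1) f) -> f = 0.
Proof.
move=> e0 fP; apply/hahnP => x; apply/eqP/negPn/negP => fx.
have /(_ (Num.bound `|x / e|)) := fun n => fP n x fx.
apply/negP; rewrite -ltNge -[e *+ _]mulr_natl -ltr_pdivrMr //.
apply: le_lt_trans (ler_norm _) _.
by apply: lt_trans (archi_boundP (normr_ge0 _)) _; rewrite ltr_nat.
Qed.

(** A positive element of (1/k)Z is at least [1/k]: on a grid, positivity becomes the uniform bound
    on which the contraction argument rests. *)
Lemma on_grid_supp_ge k (f : hahn) : (0 < k)%N -> on_grid k f ->
  (forall x, f x != 0 -> 0 < x) -> supp_ge (k%:R^-1) f.
Proof.
move=> k0 fk fpos x fx; have x0 := fpos x fx.
have /intrP[n nE] := fk x fx.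
rewrite -[k%:R^-1]mul1r ler_pdivrMr ?ltr0n // nE ler1z.
have : 0 < n%:~R :> rat by rewrite -nE mulr_gt0 ?ltr0n.
by rewrite ltr0z; lia.
Qed.

(** * Contracting equations and the Newton polygon *)

Section Contraction.
Variables (p : nat) (p_gt1 : (1 < p)%N).
Local Notation phi := (phi p_gt1).
Implicit Types f g h : hahn.

Lemma supp_ge_iter_phi i m f : supp_ge m f -> supp_ge (p%:R ^+ i * m) (iter i phi f).
Proof.
move=> fm x; rewrite hcoef_iter_phi => /fm.
by rewrite ler_pdivlMr ?ltr0pX // mulrC.
Qed.

(* The map [h |-> g - sum_i b_i phi^(i+1) h] multiplies the valuation of
   differences by at least [p], hence is contracting. *)
Lemma mahler_fixpoint (d k : nat) (b : nat -> hahn) g : (0 < k)%N ->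
  (forall i, (i < d)%N -> supp_ge 0 (b i) /\ on_grid k (b i)) ->
  on_grid k g -> (forall x, g x != 0 -> 0 < x) ->
  exists h, [/\ on_grid k h, forall x, h x != 0 -> 0 < x &
    h + \sum_(i < d) b i * iter i.+1 phi h = g].
Proof.
move=> k0 bP gk gpos.
pose e : rat := k%:R^-1; have e0 : 0 < e by rewrite invr_gt0 ltr0n.
pose S f := \sum_(i < d) b i * iter i.+1 phi f.
pose T f := g - S f; pose s n := iter n T 0.
have SB f h : S f - S h = S (f - h).
  rewrite -sumrB; apply: eq_bigr => i _; rewrite -mulrBr; congr (_ * _).
  by apply/hahnP => x; rewrite hcoefD hcoefN !hcoef_iter_phi hcoefD hcoefN.
have Sm m f : 0 <= m -> supp_ge m f -> supp_ge (p%:R * m) (S f).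
  move=> m0 fm; apply: supp_ge_sum => i _.
  apply: (@supp_ge_trans (0 + p%:R ^+ i.+1 * m)).
    rewrite add0r ler_wpM2r // exprS ler_peMr ?exprn_ege1 ?ler1n ?(ltnW p_gt1) //.
  by apply: supp_geM; [case: (bP i)|apply: supp_ge_iter_phi].
(* Multiplying the valuation by [p >= 2] takes [(n+1)e] to at least [(n+2)e]. *)
have Tm n f h : supp_ge (e *+ n.+1) (f - h) -> supp_ge (e *+ n.+2) (T f - T h).
  have -> : T f - T h = - S (f - h) by rewrite -SB /T; ring.
  move=> fh; apply: supp_geN.
  apply: supp_ge_trans (Sm _ _ _ fh); last by rewrite mulrn_wge0 ?ltW.
  rewrite -[e *+ n.+2]mulr_natl -[e *+ n.+1]mulr_natl mulrA ler_wpM2r ?(ltW e0) //.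
  by rewrite -natrM ler_nat; clear -p_gt1; nia.
have ge g' : on_grid k g' -> (forall x, g' x != 0 -> 0 < x) -> supp_ge e g'.
  exact: on_grid_supp_ge.
have sP n : supp_ge (e *+ n.+1) (s n.+1 - s n).
  elim: n => [|n IHn]; last exact: Tm.
  rewrite subr0 /s /= /T /S big1 ?subr0; first exact: ge.
  by move=> i _; rewrite [iter _ _ _](_ : _ = 0) ?mulr0 //;
     apply/hahnP => x; rewrite hcoef_iter_phi.
have [h hs] := supp_ge_lim e0 sP.
have hT : T h = h.
  apply/eqP; rewrite -subr_eq0; apply/eqP/(supp_ge_all0 e0) => n.
  have -> : T h - h = (T h - T (s n)) - (h - s n.+1) by rewrite /s /=; ring.
  apply: supp_geD; last apply: supp_geN.
    by apply: supp_ge_trans (Tm _ _ _ (hs n)); rewrite ler_wpMn2l // ltW.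
  by apply: supp_ge_trans (hs n.+1); rewrite ler_wpMn2l // ltW.
have sk n : on_grid k (s n) /\ supp_ge e (s n).
  elim: n => [|n [IHk IHe]].
    by split; [apply: on_grid0|move=> x; rewrite hcoef0 eqxx].
  split.
    apply: on_gridD => //; apply: on_gridN; apply: on_grid_sum => i _.
    apply: on_gridM; first by case: (bP i).
    by elim: (i.+1) => // j; apply: on_grid_phi.
  apply: supp_geD; first exact: ge.
  apply: supp_geN; apply: supp_ge_trans (Sm _ _ (ltW e0) IHe).
  by rewrite ler_peMl ?(ltW e0) // ler1n ltnW.
(* Each coefficient of the limit is that of some iterate, so the grid and positivity pass to [h]. *)
have hsx x : exists n, h x = s n x.
  pose n := Num.bound `|x / e|; exists n; apply/eqP.
  rewrite -subr_eq0 -hcoefN -hcoefD; apply/negPn/negP => /hs; apply/negP.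
  rewrite -ltNge -[e *+ _]mulr_natl -ltr_pdivrMr //.
  apply: le_lt_trans (ler_norm _) _.
  by apply: lt_trans (archi_boundP (normr_ge0 _)) _; rewrite ltr_nat.
exists h; split.
- by move=> x; have [n ->] := hsx x; case: (sk n) => + _; apply.
- move=> x; have [n ->] := hsx x; case: (sk n) => _ /[apply].
  exact: lt_le_trans.
- by rewrite -/(S h) -{1}hT /T subrK.
Qed.

Lemma in_puiseux_fixpoint (d : nat) (b : nat -> hahn) g :
  (forall i, (i < d)%N -> supp_ge 0 (b i) /\ in_puiseux (b i)) ->
  in_puiseux g -> (forall x, g x != 0 -> 0 < x) ->
  exists h, [/\ in_puiseux h, forall x, h x != 0 -> 0 < x &
    h + \sum_(i < d) b i * iter i.+1 phi h = g].
Proof.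
move=> bP gP gpos; pose F i := if (i < d)%N then b i else g.
have [|k k0 Fk] := @common_grid d.+1 F.
  by move=> i _; rewrite /F; case: ifP => // /bP[].
have bk i : (i < d)%N -> supp_ge 0 (b i) /\ on_grid k (b i).
  by move=> id; case: (bP i id); split=> //; have := Fk i (ltnW id); rewrite /F id.
have gk : on_grid k g by have := Fk d (ltnSn d); rewrite /F ltnn.
have [h [hk h0 hE]] := mahler_fixpoint k0 bk gk gpos.
by exists h; split=> //; apply/in_puiseuxP; exists k.
Qed.

(** Here [a i] is the coefficient of [phi^(i+1)] once that of [phi^0] is 1. Substituting [z^r h]
    shifts its exponents by [(p^(i+1) - 1)r]; the maximum [r] of [-v(a_i)/(p^(i+1) - 1)] over the
    nonzero [a_i] makes all valuations nonnegative and one of them zero. *)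
Lemma newton_slope (d : nat) (a : nat -> hahn) : a d != 0 ->
  exists r : rat,
    (forall i, (i <= d)%N -> supp_ge (- ((p%:R ^+ i.+1 - 1) * r)) (a i)) /\
    exists2 i, (i <= d)%N & a i (- ((p%:R ^+ i.+1 - 1) * r)) != 0.
Proof.
move=> ad0.
have pX (i : nat) : 0 < p%:R ^+ i.+1 - 1 :> rat.
  by rewrite subr_gt0 exprn_egt1 // ltr1n.
have /choice[v vP] i :
    exists m, a i != 0 -> a i m != 0 /\ supp_ge m (a i).
  have [->|/supp_min[m ? ?]] := eqVneq (a i) 0; first by exists 0; rewrite eqxx.
  by exists m.
pose F (i : 'I_d.+1) := - v i / (p%:R ^+ i.+1 - 1).
have [i ai0 imax] :=
  @arg_maxP _ _ _ (ord_max : 'I_d.+1) (fun i : 'I_d.+1 => a i != 0) F ad0.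
exists (F i); split=> [j jd|]; last first.
  exists i; first by rewrite -ltnS.
  by rewrite /F mulrCA mulfV ?(gt_eqF (pX i)) // mulr1 opprK; case: (vP i ai0).
have [->|aj0] := eqVneq (a j) 0; first by move=> x; rewrite hcoef0 eqxx.
have [_ vj] := vP j aj0; apply: supp_ge_trans vj.
have := imax (Ordinal (jd : (j < d.+1)%N)) aj0.
rewrite /= -/F [F (Ordinal _)]/F /= ler_pdivrMr // lerNl mulrC; exact.
Qed.

(* With [r] the largest slope of the Newton polygon, substituting [z^r h] for
   the unknown makes the coefficients integral, the one of degree 0 being a
   unit, so that [mahler_fixpoint] applies; [c] is a root of the residual
   polynomial. *)
Lemma mahler_right_factor (P : {poly hahn}) : (1 < size P)%N -> P`_0 != 0 ->
  (forall i, in_puiseux P`_i) ->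
  exists c f, [/\ c != 0, f != 0, in_puiseux f &
    \sum_(i < size P) P`_i * hconst (c ^+ i) * iter i phi f = 0].
Proof.
case szP: (size P) => [|[|d]] // _ P0 PP.
pose a i := P`_i.+1 / P`_0.
have aP i : in_puiseux (a i) by apply: in_puiseuxM => //; apply: in_puiseuxV.
have ad : a d != 0.
  rewrite mulf_neq0 ?invr_eq0 // -[d.+1]/(d.+2.-1) -szP -lead_coefE lead_coef_eq0.
  by rewrite -size_poly_eq0 szP.
have [r [ar [i0 i0d ai0]]] := newton_slope ad.
pose b i := hmonom 1 ((p%:R ^+ i.+1 - 1) * r) * a i.
have b_ge0 i : (i <= d)%N -> supp_ge 0 (b i).
  by move=> id; rewrite -(addrN ((p%:R ^+ i.+1 - 1) * r)); apply/supp_ge_monomM/ar.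
have bP i : in_puiseux (b i) by apply: in_puiseuxM => //; apply: in_puiseux_monom.
(* The residual polynomial: constant terms of the rescaled coefficients, with 1 for [phi^0]. It is
   not constant because [b i0] has a nonzero constant term. *)
pose chi : {poly algC} := \poly_(i < d.+2) (if i is j.+1 then b j 0 else 1).
have [c chic] : exists c, root chi c.
  apply/closed_rootP; apply/negP => /eqP sz1.
  have : chi`_i0.+1 = 0 by rewrite nth_default ?sz1.
  rewrite coef_poly !ltnS i0d /b hcoef_monomM mul1r sub0r => /eqP.
  by apply/negP.
have chiE : 1 + \sum_(i < d.+1) c ^+ i.+1 * b i 0 = 0.
  move/rootP: chic; rewrite horner_poly big_ord_recl /= expr0 mulr1 => chi0.
  rewrite -[RHS]chi0.
  by congr (_ + _); apply: eq_bigr => i _; rewrite mulrC.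
have c0 : c != 0.
  apply/eqP => c0; move/eqP: chiE; rewrite c0 big1 ?addr0 ?oner_eq0 // => i _.
  by rewrite expr0n mul0r.
pose B i := hconst (c ^+ i.+1) * b i.
have BP i : (i < d.+1)%N -> supp_ge 0 (B i) /\ in_puiseux (B i).
  move=> id; split; last by apply: in_puiseuxM => //; apply: in_puiseux_const.
  by rewrite -(addr0 0); apply: supp_ge_monomM; apply: b_ge0.
(* For a solution [z^r (1 + h)] the equation reads [h + sum_i B_i phi^(i+1)(h) = g], and the choice
   of the root [c] removes the constant term of [g]. *)
pose g := - (1 + \sum_(i < d.+1) B i).
have gP : in_puiseux g.
  apply: in_puiseuxN; apply: in_puiseuxD; first exact: in_puiseux_const 1.
  by apply: in_puiseux_sum => i _; case: (BP i).
have gpos x : g x != 0 -> 0 < x.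
  have g0 : g 0 = 0.
    rewrite hcoefN hcoefD hcoef_sum hcoef1 eqxx; apply/eqP; rewrite oppr_eq0.
    apply/eqP; rewrite -[RHS]chiE; congr (_ + _).
    by apply: eq_bigr => i _; rewrite hcoef_constM.
  have gge : supp_ge 0 g.
    apply: supp_geN; apply: supp_geD; last first.
      by apply: supp_ge_sum => i _; case: (BP i).
    by move=> y; rewrite hcoef1; case: (y =P 0) => [->//|_]; rewrite eqxx.
  move=> gx; rewrite lt_neqAle gge // andbT eq_sym.
  by apply: contraNneq gx => ->; rewrite g0.
have [h [hP hpos hE]] := in_puiseux_fixpoint BP gP gpos.
have f0 : 1 + h != 0.
  apply/eqP => /hahnP/(_ 0)/eqP; rewrite hcoefD hcoef1 eqxx hcoef0.
  have -> : h 0 = 0 by apply/eqP/negPn/negP => /hpos; rewrite ltxx.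
  by rewrite addr0 oner_eq0.
exists c, (hmonom 1 r * (1 + h)); split=> //.
- by rewrite mulf_neq0 // hmonom_eq0 oner_eq0.
- apply: in_puiseuxM; first exact: in_puiseux_monom.
  by apply: in_puiseuxD => //; exact: in_puiseux_const 1.
rewrite big_ord_recl /= expr0 mulr1.
have -> : \sum_(i < d.+1) P`_(bump 0 i) * hconst (c ^+ bump 0 i) *
    phi (iter i phi (hmonom 1 r * (1 + h))) =
    P`_0 * hmonom 1 r * \sum_(i < d.+1) B i * iter i.+1 phi (1 + h).
  rewrite mulr_sumr; apply: eq_bigr => i _.
  rewrite -iterS iter_phiM iter_phi_monom -[bump 0 i]/(i.+1) /B /b /a.
  have -> : hmonom 1 (p%:R ^+ i.+1 * r) =
      hmonom 1 ((p%:R ^+ i.+1 - 1) * r) * hmonom 1 r.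
    by rewrite hmonomM mulr1 mulrBl mul1r subrK.
  by field.
rewrite mulrA -mulrDr.
have -> : \sum_(i < d.+1) B i * iter i.+1 phi (1 + h) =
    \sum_(i < d.+1) B i + \sum_(i < d.+1) B i * iter i.+1 phi h.
  by rewrite -big_split; apply: eq_bigr => i _; rewrite iter_phiD iter_phi1 mulrDr mulr1.
by rewrite -/g -(addrA 1) (addrCA h) hE /g addrA subrr mulr0.
Qed.

End Contraction.

(** * Linear algebra over K_inf inside the Hahn series *)

Inductive kspan (A : hahn -> Prop) : hahn -> Prop :=
| kspan0 : kspan A 0
| kspanDM u v x : in_Kinf u -> A v -> kspan A x -> kspan A (u * v + x).

Section KSpan.
Implicit Types (A B : hahn -> Prop) (u x y : hahn).

Lemma kspanD A x y : kspan A x -> kspan A y -> kspan A (x + y).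
Proof.
move=> Ax Ay; elim: Ax => [|u v x' uK Av _ IHx]; first by rewrite add0r.
by rewrite -addrA; apply: kspanDM.
Qed.

Lemma kspanM A u x : in_Kinf u -> kspan A x -> kspan A (u * x).
Proof.
move=> uK; elim=> [|w v x' wK Av _ IHx]; first by rewrite mulr0; apply: kspan0.
by rewrite mulrDr mulrA; apply: kspanDM => //; apply: in_KinfM.
Qed.

Lemma kspan_gen A x : A x -> kspan A x.
Proof.
move=> Ax; rewrite -(addr0 x) -(mul1r x).
by apply: kspanDM => //; [apply: in_Kinf1|apply: kspan0].
Qed.

Lemma kspan_sum A I (r : seq I) (P : pred I) (F : I -> hahn) :
  (forall i, P i -> kspan A (F i)) -> kspan A (\sum_(i <- r | P i) F i).
Proof. by move=> FA; elim/big_ind: _ => //; [apply: kspan0|apply: kspanD]. Qed.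

Lemma kspanS A B x : (forall y, A y -> kspan B y) -> kspan A x -> kspan B x.
Proof.
move=> AB; elim=> [|u v x' uK /AB Bv _ IHx]; first exact: kspan0.
by apply: kspanD => //; apply: kspanM.
Qed.

Lemma kspan_cons v (vs : seq hahn) x : kspan (fun y => y \in v :: vs) x ->
  exists2 u, in_Kinf u & kspan (fun y => y \in vs) (x - u * v).
Proof.
elim=> [|u w y uK wv _ [u' u'K yS]].
  by exists 0; [apply: in_Kinf0|rewrite mul0r subr0; apply: kspan0].
move: wv; rewrite inE => /predU1P[->|wvs].
  exists (u + u'); first exact: in_KinfD.
  by rewrite mulrDl opprD addrACA subrr add0r.
by exists u' => //; rewrite -addrA; apply: kspanDM.
Qed.

(** Gaussian elimination on the generators: either no [y i] involves [v], or one that does is a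
    pivot removing [v] from the others. *)
Lemma kspan_dependent (vs : seq hahn) (y : 'I_(size vs).+1 -> hahn) :
  (forall i, kspan (fun x => x \in vs) (y i)) ->
  exists u : 'I_(size vs).+1 -> hahn, [/\ forall i, in_Kinf (u i),
    exists i, u i != 0 & \sum_i u i * y i = 0].
Proof.
elim: vs y => [|v vs IHvs] /= y yS.
  exists (fun=> 1); split; first by move=> _; apply: in_Kinf1.
    by exists ord0; apply: oner_neq0.
  rewrite big_ord1 mul1r; case: (yS ord0) => // u w x _ //.
have /choice[w wP] i : exists w, in_Kinf w /\ kspan (fun x => x \in vs) (y i - w * v).
  by have [w wK wS] := kspan_cons (yS i); exists w.
have [[m wm0]|w0] := pselect (exists m, w m != 0); last first.
  have w0' i : w i = 0 by apply/eqP/negPn/negP => wi; apply: w0; exists i.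
  have [|u [uK [i ui0] uy]] := IHvs (fun i => y (lift ord0 i)).
    by move=> i; have [_] := wP (lift ord0 i); rewrite w0' mul0r subr0.
  exists (fun i => if unlift ord0 i is Some j then u j else 0); split.
  - by move=> j; case: unlift => //; apply: in_Kinf0.
  - by exists (lift ord0 i); rewrite liftK.
  rewrite big_ord_recl unlift_none mul0r add0r -[RHS]uy.
  by apply: eq_bigr => j _; rewrite liftK.
have [|u [uK [i ui0] uy]] :=
    IHvs (fun i => y (lift m i) - w (lift m i) / w m * y m).
  move=> i; set j := lift m i.
  have -> : y j - w j / w m * y m = (y j - w j * v) + - (w j / w m) * (y m - w m * v).
    by field.
  apply: kspanD; first by case: (wP j).
  apply: kspanM; last by case: (wP m).
  apply: in_KinfN; apply: in_KinfM; first by case: (wP j).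
  by apply: in_KinfV; case: (wP m).
(* The coefficient of the pivot [y m], collecting the multiples of it subtracted from the other
   vectors. *)
pose um := - \sum_j u j * (w (lift m j) / w m).
exists (fun i => if unlift m i is Some j then u j else um); split.
- move=> j; case: unlift => // ; apply: in_KinfN; apply: in_Kinf_sum => l _.
  apply: in_KinfM => //; apply: in_KinfM; first by case: (wP (lift m l)).
  by apply: in_KinfV; case: (wP m).
- by exists (lift m i); rewrite liftK.
rewrite (bigD1_ord m) //= unlift_none -[RHS]uy mulNr mulr_suml -sumrN -big_split /=.
by apply: eq_bigr => j _; rewrite liftK; ring.
Qed.

End KSpan.

(** * Finite-dimensional [phi]-stable spaces and Mahler equations *)

Section PhiFinite.
Variables (p : nat) (p_gt1 : (1 < p)%N).
Local Notation phi := (phi p_gt1).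
Implicit Types f g h x : hahn.

Definition phi_stable (vs : seq hahn) :=
  forall v, v \in vs -> kspan (fun y => y \in vs) (phi v).

(** A form of the p-Mahler property for which sums and inhomogeneous equations require no
    computation with operators. *)
Definition phi_finite x :=
  exists2 vs, phi_stable vs & kspan (fun y => y \in vs) x.

Lemma kspan_phi vs x : phi_stable vs -> kspan (fun y => y \in vs) x ->
  kspan (fun y => y \in vs) (phi x).
Proof.
move=> vsS; elim=> [|u v y uK /vsS vS _ IHy]; first by rewrite rmorph0; apply: kspan0.
rewrite rmorphD rmorphM; apply: kspanD => //; apply: kspanM => //.
exact: in_Kinf_phi.
Qed.

Lemma phi_stable_cat vs ws : phi_stable vs -> phi_stable ws -> phi_stable (vs ++ ws).
Proof.
move=> vsS wsS v; rewrite mem_cat => /orP[/vsS|/wsS]; apply: kspanS => y yin;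
  by apply: kspan_gen; rewrite mem_cat yin ?orbT.
Qed.

Lemma phi_finite0 : phi_finite 0.
Proof. by exists [::] => //; apply: kspan0. Qed.

Lemma phi_finiteD x y : phi_finite x -> phi_finite y -> phi_finite (x + y).
Proof.
move=> [vs vsS xS] [ws wsS yS]; exists (vs ++ ws); first exact: phi_stable_cat.
by apply: kspanD; [apply: kspanS xS|apply: kspanS yS] => v vin;
  apply: kspan_gen; rewrite mem_cat vin ?orbT.
Qed.

Lemma phi_finiteM u x : in_Kinf u -> phi_finite x -> phi_finite (u * x).
Proof. by move=> uK [vs vsS xS]; exists vs => //; apply: kspanM. Qed.

Lemma phi_finite_phi x : phi_finite x -> phi_finite (phi x).
Proof. by move=> [vs vsS xS]; exists vs => //; apply: kspan_phi. Qed.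

(** Adjoining [x, ..., phi^(d-1) x] to a stable space containing the right-hand side gives a stable
    space, since the equation expresses [phi^d x] in it. *)
Lemma phi_finite_solution (d : nat) (a : nat -> hahn) x :
  (forall i, in_Kinf (a i)) -> a d != 0 ->
  phi_finite (\sum_(i < d.+1) a i * iter i phi x) -> phi_finite x.
Proof.
move=> aK ad0 [ws wsS gS]; pose xs := traject phi x d.
have xsS n : (n <= d)%N -> kspan (fun y => y \in xs ++ ws) (iter n phi x).
  rewrite leq_eqVlt => /predU1P[->|nd]; last first.
    apply: kspan_gen; rewrite mem_cat; apply/orP; left.
    by apply/trajectP; exists n.
  set g := \sum_(i < _) _ in gS.
  have -> : iter d phi x = (a d)^-1 * (g + - \sum_(i < d) a i * iter i phi x).
    by rewrite /g big_ord_recr /= addrAC subrr add0r mulKf.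
  apply: kspanM; first exact: in_KinfV.
  apply: kspanD; first by apply: kspanS gS => y yin; apply: kspan_gen; rewrite mem_cat yin orbT.
  rewrite -sumrN; apply: kspan_sum => i _; rewrite -mulNr; apply: kspanM.
    exact: in_KinfN.
  apply: kspan_gen; rewrite mem_cat; apply/orP; left.
  by apply/trajectP; exists i.
exists (xs ++ ws); last exact: (xsS 0%N).
move=> v; rewrite mem_cat => /orP[/trajectP[i id ->]|/wsS]; first exact: (xsS i.+1).
by apply: kspanS => y yin; apply: kspan_gen; rewrite mem_cat yin orbT.
Qed.

(** A zero top coefficient is dropped. If the coefficient of [phi^0] is zero, the relation is the
    image under the injective [phi] of a shorter one, whose coefficients are again in K_inf. *)
Lemma mahler_relation_normalize n (u : nat -> hahn) x :
  (forall i, in_Kinf (u i)) -> (exists2 i, (i < n)%N & u i != 0) ->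
  \sum_(i < n) u i * iter i phi x = 0 ->
  exists (d : nat) (a : 'I_d.+1 -> hahn), mahler_coefs a /\
    \sum_(i < d.+1) a i * iter i phi x = 0.
Proof.
elim: n u => [|n IHn] u uK; first by case.
move=> [i0 i0n ui0] ux.
have [un0|un0] := eqVneq (u n) 0.
  apply: (IHn u) => //; last by rewrite big_ord_recr /= un0 mul0r addr0 in ux.
  exists i0 => //; move: i0n; rewrite ltnS leq_eqVlt => /predU1P[i0E|//].
  by rewrite i0E un0 eqxx in ui0.
have [u00|u00] := eqVneq (u 0%N) 0; last first.
  exists n, (fun i => u i); split=> //; split=> //.
  by rewrite mulf_neq0.
have /choice[w wP] i : exists w, in_Kinf w /\ phi w = u i.+1.
  by have [w wK wE] := in_Kinf_phiV p_gt1 (uK i.+1); exists w.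
apply: (IHn w) => [i||]; first by case: (wP i).
  case: i0 i0n ui0 => [|i0 i0n ui0]; first by rewrite u00 eqxx.
  by exists i0 => //; rewrite -(phi_eq0 p_gt1); case: (wP i0) => _ ->.
apply: (phi_inj (p_gt1 := p_gt1)); rewrite rmorph0 rmorph_sum -[RHS]ux big_ord_recl u00.
by rewrite mul0r add0r; apply: eq_bigr => i _; rewrite rmorphM; case: (wP i) => _ /= ->.
Qed.

(** All iterates of [x] stay in the span of [vs], so [size vs + 1] of them are dependent. *)
Lemma phi_finite_mahler x : phi_finite x ->
  exists (d : nat) (a : 'I_d.+1 -> hahn), mahler_coefs a /\
    \sum_(i < d.+1) a i * iter i phi x = 0.
Proof.
move=> [vs vsS xS].
have xiS i : kspan (fun y => y \in vs) (iter i phi x).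
  by elim: i => // i; apply: kspan_phi.
have [u [uK [i ui0] ux]] := kspan_dependent (fun i : 'I_(size vs).+1 => xiS i).
pose u' n := if insub n is Some j then u j else 0.
have u'E j : u' (j : 'I_(size vs).+1) = u j by rewrite /u' valK.
apply: (@mahler_relation_normalize (size vs).+1 u').
- by move=> n; rewrite /u'; case: insubP => // _; apply: in_Kinf0.
- by exists i; rewrite ?u'E.
- by rewrite -[RHS]ux; apply: eq_bigr => j _; rewrite u'E.
Qed.

End PhiFinite.

(** * The action of [phi] on the series xi *)

Section XiShift.
Variables (p : nat) (p_gt1 : (1 < p)%N).
Local Notation phi := (phi p_gt1).
Implicit Types (t n al be : nat) (la : nzC) (a : posQ).

Definition lcons t al la a (w : Lambda_ t) : Lambda_ t.+1 :=
  ([tuple of al :: w.1.1], [tuple of la :: w.1.2], [tuple of a :: w.2]).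

Definition lambda_prod t (w : Lambda_ t) : algC :=
  \prod_(i < t) sval (tnth w.1.2 i).

Lemma lambda_prod_cons t al la a (w : Lambda_ t) :
  lambda_prod (lcons al la a w) = sval la * lambda_prod w.
Proof.
rewrite /lambda_prod big_ord_recl; congr (_ * _).
by apply: eq_bigr => i _; rewrite tnthS.
Qed.

Lemma psum_cons0 t n (k : t.-tuple nat) : psum [tuple of n :: k] ord0 = n.
Proof.
by rewrite /psum big_mkcond big_ord_recl /= big1 ?addn0.
Qed.

Lemma psum_consS t n (k : t.-tuple nat) i :
  psum [tuple of n :: k] (lift ord0 i) = (n + psum k i)%N.
Proof.
rewrite /psum big_mkcond big_ord_recl /= [in RHS]big_mkcond; congr (_ + _)%N.
by apply: eq_bigr => j _; rewrite tnthS.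
Qed.

(** The first index [k_1] occurs in every partial sum, so it factors out of the exponent as
    [p^(-k_1)]; likewise [(lambda_1 ... lambda_t)^(k_1)] factors out of [xi_term]. *)
Lemma xi_expo_cons t al la a (w : Lambda_ t) n (k : t.-tuple nat) :
  xi_expo p (lcons al la a w) [tuple of n :: k] =
  (- sval a + xi_expo p w k) / p%:R ^+ n.
Proof.
rewrite /xi_expo big_ord_recl psum_cons0 mulrDl mulNr; congr (_ + _).
rewrite mulr_suml; apply: eq_bigr => i _; rewrite psum_consS tnthS mulNr.
by rewrite exprD invfM mulrA mulrAC.
Qed.

Lemma xi_term_cons t al la a (w : Lambda_ t) n (k : t.-tuple nat) :
  xi_term (lcons al la a w) [tuple of n :: k] =
  n%:R ^+ al * lambda_prod (lcons al la a w) ^+ n * xi_term w k.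
Proof.
rewrite lambda_prod_cons /xi_term !big_ord_recl psum_cons0 /= !tnth0.
have -> : \prod_(i < t) sval (tnth [tuple of la :: w.1.2] (lift ord0 i)) ^+
    psum [tuple of n :: k] (lift ord0 i) =
    lambda_prod w ^+ n * \prod_(i < t) sval (tnth w.1.2 i) ^+ psum k i.
  rewrite /lambda_prod -prodrXl -big_split; apply: eq_bigr => i _.
  by rewrite psum_consS tnthS exprD.
have -> : \prod_(i < t) (tnth [tuple of n :: k] (lift ord0 i))%:R ^+
    tnth [tuple of al :: w.1.1] (lift ord0 i) =
    \prod_(i < t) (tnth k i)%:R ^+ tnth w.1.1 i :> algC.
  by apply: eq_bigr => i _; rewrite !tnthS.
by rewrite exprMn; ring.
Qed.

(* Separates the indices with [k_1 = 1] from those with [k_1 > 1]. *)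
Lemma phi_xi_cons t al la a (w : Lambda_ t) :
  phi (xi_ p_gt1 (lcons al la a w)) =
  hconst (lambda_prod (lcons al la a w)) *
    (hmonom 1 (- sval a) * xi_ p_gt1 w +
     \sum_(be < al.+1) hconst ('C(al, be))%:R * xi_ p_gt1 (lcons be la a w)).
Proof.
have pV0 : p%:R^-1 != 0 :> rat by rewrite invr_eq0 pnatr_neq0.
apply/hahnP => x; rewrite hcoef_phi hcoef_constM hcoefD hcoef_monomM mul1r opprK.
rewrite hcoef_sum; under eq_bigr do rewrite hcoef_constM.
rewrite /= /xi_coef; set mu := lambda_prod _.
have mu_be be : lambda_prod (lcons be la a w) = mu.
  by rewrite /mu !lambda_prod_cons.
pose I0 := xi_index p w (x + sval a).
pose I1 := xi_index p (lcons al la a w) x.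
have I1E be : xi_index p (lcons be la a w) x = I1 by [].
pose h0 (k : t.-tuple nat) : t.+1.-tuple nat := [tuple of 1%N :: k].
pose h1 (k : t.+1.-tuple nat) : t.+1.-tuple nat :=
  [tuple of (thead k).+1 :: [tuple of behead k]].
(* At [k_1 = 1] the factor [1/p] cancels on both sides and the tail has exponent [x + a_1]; at
   [k_1 > 1] one factor [1/p] cancels, leaving with [k_1 - 1] an index of exponent [x]. *)
have IE : xi_index p (lcons al la a w) (x / p%:R) = (h0 @` I0) `|` (h1 @` I1).
  apply/seteqP; split=> [k [k1 kx]|_ [[k [k1 kx] <-]|[k [k1 kx] <-]]].
  - move: k1 kx; case/tupleP: k => n k k1 kx.
    have k1' i : (1 <= tnth k i)%N by have := k1 (lift ord0 i); rewrite tnthS.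
    have := k1 ord0; rewrite tnth0 => n0.
    case: n n0 k1 kx => [//|[|n]] _ k1 kx.
      left; exists k => //; split=> //.
      move: kx; rewrite xi_expo_cons expr1 => /(mulIf pV0) <-.
      by rewrite addrC addrA subrr add0r.
    right; exists [tuple of n.+1 :: k].
      split=> [i|]; first by case: (unliftP ord0 i) => [j ->|->]; rewrite ?tnthS.
      move: kx; rewrite !xi_expo_cons (exprSr _ n.+1) invfM mulrA.
      exact: (mulIf pV0).
    by apply: val_inj.
  - split=> [i|]; first by case: (unliftP ord0 i) => [j ->|->]; rewrite ?tnthS.
    by rewrite xi_expo_cons kx expr1 addrC addrK.
  - move: k1 kx; case/tupleP: k => n k k1 kx.
    have -> : h1 [tuple of n :: k] = [tuple of n.+1 :: k] by apply: val_inj.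
    split=> [i|].
      case: (unliftP ord0 i) => [j ->|->]; rewrite ?tnthS //.
      by have := k1 (lift ord0 j); rewrite tnthS.
    by rewrite -kx !xi_expo_cons exprSr invfM mulrA.
have fin0 : finite_set I0 by apply: finite_xi_index.
have fin1 : finite_set I1 by apply: finite_xi_index.
have inj0 : set_inj I0 h0 by move=> k l _ _ /(congr1 val) [kl]; apply: val_inj.
have inj1 : set_inj I1 h1.
  move=> k l _ _; case/tupleP: k => n k; case/tupleP: l => m l.
  by move=> /(congr1 val) /=; rewrite !theadE => -[nm kl]; apply: val_inj; rewrite /= nm kl.
(* The first entry is 1 on the image of [h0] and at least 2 on that of [h1]. *)
rewrite IE fsbigU0; first last.
- move=> _ [[k _ <-] [l [l1 _]]].
  move=> /(congr1 (fun s : _.-tuple _ => tnth s ord0)); rewrite !tnth0 => -[l0].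
  by have := l1 ord0; rewrite -[tnth l ord0]/(thead l) l0.
- exact: finite_image.
- exact: finite_image.
rewrite !fsbig_image // mulrDr; congr (_ + _).
  rewrite mulr_fsumr; apply: eq_fsbigr => k _.
  by rewrite xi_term_cons expr1n mul1r expr1.
have -> : \sum_(i < al.+1) 'C(al, i)%:R *
    \sum_(k \in xi_index p (lcons i la a w) x) xi_term (lcons i la a w) k =
    \sum_(k \in I1) \sum_(i < al.+1) 'C(al, i)%:R * xi_term (lcons i la a w) k :> algC.
  rewrite fsbig_finite // exchange_big /=; apply: eq_bigr => i _.
  by rewrite I1E -fsbig_finite // mulr_fsumr.
rewrite mulr_fsumr; apply: eq_fsbigr => k _; case/tupleP: k => n k.
have -> : h1 [tuple of n :: k] = [tuple of n.+1 :: k] by apply: val_inj.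
rewrite xi_term_cons -/mu -natr1 exprDn big_distrl big_distrl big_distrr /=.
(* [exprDn] gives [n^(al - i)] the index [i]; reversing the sum makes the index the exponent of
   [n]. *)
rewrite (reindex_inj rev_ord_inj) /=; apply: eq_bigr => i _.
rewrite xi_term_cons mu_be expr1n mulr1 subSS subKn -1?ltnS // exprS bin_sub -1?ltnS //.
by rewrite -mulr_natl; ring.
Qed.

End XiShift.

(* The triple [(alpha_i, lambda_i, a_i)]. *)
Notation letter := (nat * nzC * posQ)%type.

(** * Words of letters in place of [Lambda] *)

(** Lists avoid the dependent length in [Lambda] and make recursion on the first letter
    structural. *)
Fixpoint word_Lambda (s : seq letter) : Lambda :=
  if s is (al, la, a) :: s' then
    existT Lambda_ _ (lcons al la a (projT2 (word_Lambda s')))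
  else existT Lambda_ 0%N ([tuple], [tuple], [tuple]).

Definition Lambda_word (w : Lambda) : seq letter :=
  zip (zip (projT2 w).1.1 (projT2 w).1.2) (projT2 w).2.

Lemma word_LambdaK : cancel word_Lambda Lambda_word.
Proof. by elim=> // [[[al la] a] s IHs]; rewrite -[in RHS]IHs. Qed.

Lemma word_Lambda_surj t (w : Lambda_ t) : exists s, word_Lambda s = existT Lambda_ t w.
Proof.
elim: t w => [|t IHt] [[u v] w].
  by exists [::]; rewrite [u]tuple0 [v]tuple0 [w]tuple0.
case/tupleP: u => al u; case/tupleP: v => la v; case/tupleP: w => a w.
have [s sE] := IHt (u, v, w); exists ((al, la, a) :: s) => /=; rewrite sE.
by [].
Qed.

Lemma Lambda_wordK : cancel Lambda_word word_Lambda.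
Proof.
by move=> [t w]; have [s <-] := word_Lambda_surj w; rewrite word_LambdaK.
Qed.

Definition word_prod (s : seq letter) : algC := \prod_(x <- s) sval x.1.2.

Lemma word_prod_neq0 s : word_prod s != 0.
Proof. by rewrite prodf_seq_neq0; apply/allP => x _; apply: (svalP x.1.2). Qed.

Lemma lambda_prod_word s : lambda_prod (projT2 (word_Lambda s)) = word_prod s.
Proof.
elim: s => [|[[al la] a] s IHs]; first by rewrite /lambda_prod /word_prod big_ord0 big_nil.
by rewrite /= lambda_prod_cons IHs /word_prod big_cons.
Qed.

Section WordXi.
Variables (p : nat) (p_gt1 : (1 < p)%N).
Local Notation phi := (phi p_gt1).

Definition word_xi (s : seq letter) : hahn := xi p_gt1 (word_Lambda s).

Lemma word_xi_nil : word_xi [::] = 1.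
Proof. exact: xi0. Qed.

Lemma phi_word_xi_cons al la a s :
  phi (word_xi ((al, la, a) :: s)) =
  hconst (word_prod ((al, la, a) :: s)) *
    (hmonom 1 (- sval a) * word_xi s +
     \sum_(be < al.+1) hconst ('C(al, be))%:R * word_xi ((be : nat, la, a) :: s)).
Proof.
rewrite /word_xi /xi [projT2 _]/= phi_xi_cons; congr (hconst _ * _).
by rewrite -(lambda_prod_word ((al, la, a) :: s)).
Qed.

End WordXi.

(** * Additive and semilinear maps on free modules *)

Section LinearExtension.
Variables (K : choiceType) (G V : zmodType) (T : G -> K -> V).
Hypothesis T_additive : forall k, {morph T^~ k : x y / x - y}.

(** [T] is only additive in the coefficient, so that this covers both the semilinear action of [phi]
    and the evaluation in a ring. *)
Definition malg_ext (v : {malg G[K]}) : V := \sum_(k <- msupp v) T v@_k k.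

Lemma malg_ext0 k : T 0 k = 0.
Proof. by rewrite -(subrr 0) T_additive subrr. Qed.

Lemma malg_extEw (D : {fset K}) v : (msupp v `<=` D)%fset ->
  malg_ext v = \sum_(k <- D) T v@_k k.
Proof.
move=> le; rewrite [LHS](big_fset_incl _ le) => //= k kD /mcoeff_outdom ->.
exact: malg_ext0.
Qed.

Lemma malg_extB : {morph malg_ext : u v / u - v}.
Proof.
move=> u v; pose D := (msupp u `|` msupp v)%fset.
rewrite !(@malg_extEw D) ?fsubsetUl ?fsubsetUr ?msuppB_le //.
by rewrite -sumrB; apply: eq_bigr => k _; rewrite mcoeffB T_additive.
Qed.

Lemma malg_extU x k : malg_ext << x *g k >> = T x k.
Proof. by rewrite (malg_extEw msuppU_le) big_seq_fset1 mcoeffUU. Qed.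

End LinearExtension.

(** Only the terms of [v] itself have to be treated, so properties of its coefficients can be used
    there. *)
Lemma malg_ind (K : choiceType) (G : zmodType) (Q : {malg G[K]} -> Prop) :
  Q 0 -> (forall u v, Q u -> Q v -> Q (u + v)) ->
  forall v : {malg G[K]}, (forall k, v@_k != 0 -> Q << v@_k *g k >>) -> Q v.
Proof.
move=> Q0 QD v Qv; rewrite [v]monalgE big_seq; elim/big_ind: _ => // k.
by rewrite -mcoeff_neq0; apply: Qv.
Qed.

Lemma scale_malgU (K : choiceType) (G : nzRingType) (x y : G) (k : K) :
  x *: << y *g k >> = << x * y *g k >>.
Proof. by apply/malgP => k'; rewrite mcoeffZ !mcoeffU mulrnAr. Qed.

Section SemilinearExtension.
Variables (F : fieldType) (phi : {rmorphism F -> F}) (K : choiceType).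
Variable g : K -> {malg F[K]}.

Definition semilinear_ext : {malg F[K]} -> {malg F[K]} :=
  malg_ext (fun x k => phi x *: g k).

Fact semilinear_ext_subproof k : {morph (fun x => phi x *: g k) : x y / x - y}.
Proof. by move=> x y; rewrite rmorphB scalerBl. Qed.

Fact semilinear_ext_zmod : zmod_morphism semilinear_ext.
Proof. exact: (malg_extB semilinear_ext_subproof). Qed.
HB.instance Definition _ := GRing.isZmodMorphism.Build
  {malg F[K]} {malg F[K]} semilinear_ext semilinear_ext_zmod.

Lemma semilinear_extU x k : semilinear_ext << x *g k >> = phi x *: g k.
Proof. exact: (malg_extU semilinear_ext_subproof). Qed.

Lemma semilinear_extZ x v : semilinear_ext (x *: v) = phi x *: semilinear_ext v.
Proof.
apply: (malg_ind (Q := fun v => semilinear_ext (x *: v) = phi x *: semilinear_ext v))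
  => [|u w uP wP|k _].
- by rewrite scaler0 raddf0 scaler0.
- by rewrite scalerDr !raddfD /= uP wP.
by rewrite scale_malgU !semilinear_extU rmorphM scalerA.
Qed.

End SemilinearExtension.

Section RingExtension.
Variables (F : fieldType) (K : choiceType) (R : comNzRingType).
Variables (iota : {rmorphism F -> R}) (g : K -> R).

Definition malg_ring_ext : {malg F[K]} -> R := malg_ext (fun x k => iota x * g k).

Fact malg_ring_ext_subproof k : {morph (fun x => iota x * g k) : x y / x - y}.
Proof. by move=> x y; rewrite rmorphB mulrBl. Qed.

Fact malg_ring_ext_zmod : zmod_morphism malg_ring_ext.
Proof. exact: (malg_extB malg_ring_ext_subproof). Qed.
HB.instance Definition _ := GRing.isZmodMorphism.Build
  {malg F[K]} R malg_ring_ext malg_ring_ext_zmod.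

Lemma malg_ring_extU x k : malg_ring_ext << x *g k >> = iota x * g k.
Proof. exact: (malg_extU malg_ring_ext_subproof). Qed.

Lemma malg_ring_extZ x v : malg_ring_ext (x *: v) = iota x * malg_ring_ext v.
Proof.
apply: (malg_ind (Q := fun v => malg_ring_ext (x *: v) = iota x * malg_ring_ext v))
  => [|u w uP wP|k _].
- by rewrite scaler0 raddf0 mulr0.
- by rewrite scalerDr !raddfD /= uP wP mulrDr.
by rewrite scale_malgU !malg_ring_extU rmorphM mulrA.
Qed.

End RingExtension.

(* [(c, j, s)] stands for [e_c ell^j xi_s]. *)
Notation gen_index := (nzC * nat * seq letter)%type.

(** * The order on the generators *)

Definition head_alpha (s : seq letter) : nat := if s is x :: _ then x.1.1 else 0%N.

(** The order making [phi] triangular: expanding [(ell + 1)^j] lowers the power of [ell], and the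
    recursion for xi shortens the word or lowers [alpha_1]. *)
Definition lower (k' k : gen_index) : bool :=
  let: (_, j', s') := k' in let: (_, j, s) := k in
  (j' < j)%N || (j' == j) && ((size s' < size s)%N ||
    (size s' == size s) && (head_alpha s' < head_alpha s)%N).

Lemma lower_trans : transitive lower.
Proof. by move=> [[? ?] ?] [[? ?] ?] [[? ?] ?]; rewrite /lower; lia. Qed.

Lemma lower_irr k : lower k k = false.
Proof. by case: k => [[? ?] ?]; rewrite /lower; lia. Qed.

Lemma lower_ind (Q : gen_index -> Prop) :
  (forall k, (forall k', lower k' k -> Q k') -> Q k) -> forall k, Q k.
Proof.
move=> IH [[c j] s]; move: c s.
have [n] := ubnP j; elim: n j => // n IHn j jn c s; move: c.
have [m] := ubnP (size s); elim: m s => // m IHm s sm c.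
have [l] := ubnP (head_alpha s); elim: l s sm c => // l IHl s sm c sl.
apply: IH => -[[c' j'] s'] /orP[lt_j|/andP[/eqP -> /orP[lt_s|/andP[/eqP eq_s lt_a]]]].
- by apply: IHn; lia.
- by apply: IHm; lia.
- by apply: IHl; lia.
Qed.

(* [F], [base] and [puis] stand for [hahn], [in_Kinf] and [in_puiseux], and
   [fin] for [phi_finite]: unification would otherwise unfold the arithmetic
   of Hahn series. *)
Section FormalSeries.
Variables (F : fieldType) (phi : {rmorphism F -> F}) (cst : {rmorphism algC -> F}).
Variables (mono : posQ -> F) (base puis : F -> Prop).
Hypothesis phi_cst : forall b, phi (cst b) = cst b.
Hypothesis base_cst : forall b, base (cst b).
Hypothesis base_mono : forall a, base (mono a).
Hypothesis baseD : forall x y, base x -> base y -> base (x + y).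
Hypothesis baseM : forall x y, base x -> base y -> base (x * y).
Hypothesis base_puis : forall x, base x -> puis x.
Hypothesis puisD : forall x y, puis x -> puis y -> puis (x + y).
Hypothesis puisM : forall x y, puis x -> puis y -> puis (x * y).
Hypothesis puis_phi : forall x, puis x -> puis (phi x).
(** A Puiseux series is the sum of a series with positive exponents, for which [m phi(h) - c h = x]
    is solvable by contraction, a constant, and finitely many monomials of negative exponent. *)
Hypothesis puis_ind : forall Q : F -> Prop,
  (forall x y, Q x -> Q y -> Q (x + y)) ->
  (forall x, (forall m c : algC, c != 0 ->
     exists2 h, puis h & cst m * phi h - cst c * h = x) -> Q x) ->
  (forall b, Q (cst b)) -> (forall b a, Q (cst b * mono a)) ->
  forall x, puis x -> Q x.

Hypothesis right_factor : forall P : {poly F}, (1 < size P)%N -> P`_0 != 0 ->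
  (forall i, puis P`_i) ->
  exists (c : algC) f, [/\ c != 0, f != 0, puis f &
    \sum_(i < size P) P`_i * cst (c ^+ i) * iter i phi f = 0].

Variables (R : comNzRingType) (iota : {rmorphism F -> R}) (sigma : {rmorphism R -> R}).
Variables (ell : R) (e : nzC -> R) (word : seq letter -> F).
Hypothesis sigma_iota : forall x, sigma (iota x) = iota (phi x).
Hypothesis sigma_ell : sigma ell = ell + 1.
Hypothesis sigma_e : forall c : nzC, sigma (e c) = iota (cst (sval c)) * e c.
Hypothesis e_inv : forall c : nzC, exists u : R, u * e c = 1.
Hypothesis word_nil : word [::] = 1.
Hypothesis phi_word_cons : forall al la a s, phi (word ((al, la, a) :: s)) =
  cst (word_prod ((al, la, a) :: s)) * (mono a * word s +
    \sum_(be < al.+1) cst 'C(al, be)%:R * word ((be : nat, la, a) :: s)).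
Variable fin : F -> Prop.
Hypothesis fin0 : fin 0.
Hypothesis finD : forall x y, fin x -> fin y -> fin (x + y).
Hypothesis finM : forall x y, base x -> fin y -> fin (x * y).
Hypothesis fin_phi : forall x, fin x -> fin (phi x).
Hypothesis fin_solution : forall (d : nat) (a : nat -> F) x,
  (forall i, base (a i)) -> a d != 0 ->
  fin (\sum_(i < d.+1) a i * iter i phi x) -> fin x.

(** * Triangular action on the module of formal symbols *)

Section FormalModule.
Variables (M : lmodType F) (E : gen_index -> M) (mcoef : gen_index -> M -> F).
Hypothesis mcoefD : forall k, {morph mcoef k : u v / u + v}.
Hypothesis mcoefZ : forall k x v, mcoef k (x *: v) = x * mcoef k v.
Hypothesis mcoefE : forall k k', mcoef k (E k') = (k == k')%:R.
Hypothesis M_ind : forall Q : M -> Prop, Q 0 ->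
  (forall u v, Q u -> Q v -> Q (u + v)) ->
  forall v, (forall k, mcoef k v != 0 -> Q (mcoef k v *: E k)) -> Q v.

Implicit Types (c : nzC) (j : nat) (s : seq letter) (k : gen_index).
Implicit Types (u v w : M) (P : {poly F}).

(* The formal value of [e_c ell^j phi(xi_s)]. *)
Definition xi_shift c j s : M :=
  if s is (al, la, a) :: s' then
    cst (word_prod s) *: (mono a *: E (c, j, s') +
      \sum_(be < al.+1) cst 'C(al, be)%:R *: E (c, j, (be : nat, la, a) :: s'))
  else E (c, j, [::]).

(* The formal value of [phi(e_c ell^j xi_s)]. *)
Definition gen_shift k : M :=
  cst (sval k.1.1) *:
    \sum_(i < k.1.2.+1) cst 'C(k.1.2, i)%:R *: xi_shift k.1.1 i k.2.

Variable Phi : {additive M -> M}.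
Hypothesis PhiZ : forall x v, Phi (x *: v) = phi x *: Phi v.
Hypothesis PhiE : forall k, Phi (E k) = gen_shift k.

Definition base_on (D : gen_index -> Prop) v :=
  forall k, base (mcoef k v) /\ (mcoef k v != 0 -> D k).

Lemma base0 : base 0. Proof. by rewrite -(rmorph0 cst). Qed.
Lemma base1 : base 1. Proof. by rewrite -(rmorph1 cst). Qed.
Hint Resolve base0 base1 : core.

Lemma mcoef0 k : mcoef k 0 = 0.
Proof. by rewrite -(scale0r 0) mcoefZ mul0r. Qed.

Lemma base_on0 D : base_on D 0.
Proof. by move=> k; rewrite mcoef0 eqxx. Qed.

Lemma base_onD D u v : base_on D u -> base_on D v -> base_on D (u + v).
Proof.
move=> uD vD k; rewrite mcoefD; have [uK uk] := uD k; have [vK vk] := vD k.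
split; first exact: baseD.
by have [->|/uk //] := eqVneq (mcoef k u) 0; rewrite add0r => /vk.
Qed.

Lemma base_on_sum D I (r : seq I) (P : pred I) (G : I -> M) :
  (forall i, P i -> base_on D (G i)) -> base_on D (\sum_(i <- r | P i) G i).
Proof.
by move=> GD; elim/big_ind: _ => //; [apply: base_on0|apply: base_onD].
Qed.

Lemma base_onZ D x v : base x -> base_on D v -> base_on D (x *: v).
Proof.
move=> xK vD k; rewrite mcoefZ; have [vK vk] := vD k.
by split; [apply: baseM|rewrite mulf_eq0 negb_or => /andP[_ /vk]].
Qed.

Lemma base_onE (D : gen_index -> Prop) k : D k -> base_on D (E k).
Proof.
move=> Dk k'; rewrite mcoefE; case: (k' =P k) => [->|_]; first by split.
by rewrite mulr0n eqxx.
Qed.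

Lemma base_onS (D D' : gen_index -> Prop) v :
  (forall k, D k -> D' k) -> base_on D v -> base_on D' v.
Proof. by move=> DD' vD k; have [vK vk] := vD k; split=> // /vk /DD'. Qed.

Lemma xi_shiftE c j s : exists2 r,
  base_on (fun k => lower k (c, j, s)) r &
  xi_shift c j s = cst (word_prod s) *: E (c, j, s) + r.
Proof.
case: s => [|[[al la] a] s].
  exists 0; first exact: base_on0.
  by rewrite addr0 /word_prod big_nil rmorph1 scale1r.
rewrite /xi_shift; set mu := word_prod _.
rewrite big_ord_recr /= binn rmorph1 addrA scalerDr scale1r.
eexists; last exact: addrC.
apply: base_onZ => //; apply: base_onD.
  by apply: base_onZ => //; apply: base_onE; rewrite /lower /= ltnSn eqxx orbT.
apply: base_on_sum => i _; apply: base_onZ => //; apply: base_onE.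
by rewrite /lower /= !eqxx !ltnn /= ltn_ord.
Qed.

(** Isolates the top power of [ell] but keeps [xi_shift] intact, because [resolvable_gen] reads off
    a term of it below the diagonal. *)
Lemma gen_shift_topE c j s : exists2 r,
  base_on (fun k => (k.1.2 < j)%N) r &
  gen_shift (c, j, s) = cst (sval c) *: xi_shift c j s + r.
Proof.
rewrite /gen_shift /= big_ord_recr /= binn rmorph1 scale1r scalerDr.
eexists; last exact: addrC.
apply: base_onZ => //; apply: base_on_sum => i _; apply: base_onZ => //.
have [r rlow ->] := xi_shiftE c i s.
apply: base_onD.
  by apply: base_onZ => //; apply: base_onE; apply: ltn_ord.
apply: base_onS rlow => -[[c' j'] s'] /= low.
by have := ltn_ord i; move: low; rewrite /lower; lia.
Qed.

(** The diagonal entry of [Phi] at [k]. *)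
Definition gen_eigen k : algC := sval k.1.1 * word_prod k.2.

Lemma gen_eigen_neq0 k : gen_eigen k != 0.
Proof. by rewrite mulf_neq0 ?word_prod_neq0 // (svalP k.1.1). Qed.

Lemma gen_shiftE k : exists2 r,
  base_on (fun k' => lower k' k) r &
  gen_shift k = cst (gen_eigen k) *: E k + r.
Proof.
case: k => [[c j] s]; have [r rlow ->] := gen_shift_topE c j s.
have [r' r'low ->] := xi_shiftE c j s.
rewrite scalerDr scalerA -rmorphM -addrA; eexists; last by [].
apply: base_onD; first exact: base_onZ r'low.
by apply: base_onS rlow => -[[c' j'] s'] /= ->.
Qed.

(** * First-order equations over Puiseux coefficients *)

Definition puis_coefs v := forall k, puis (mcoef k v).

Lemma puis_coefs_base D v : base_on D v -> puis_coefs v.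
Proof. by move=> vD k; have [/base_puis] := vD k. Qed.

Lemma puis_coefsD u v : puis_coefs u -> puis_coefs v -> puis_coefs (u + v).
Proof. by move=> uP vP k; rewrite mcoefD; apply: puisD. Qed.

Lemma puis_coefsZ x v : puis x -> puis_coefs v -> puis_coefs (x *: v).
Proof. by move=> xP vP k; rewrite mcoefZ; apply: puisM. Qed.

Lemma puis_coefsE k : puis_coefs (E k).
Proof. by apply: (@puis_coefs_base (eq k)); apply: base_onE. Qed.

Definition resolvable (b : algC) u :=
  exists2 w, puis_coefs w & Phi w - cst b *: w = u.

Lemma resolvable0 b : resolvable b 0.
Proof.
exists 0; first by move=> k; rewrite mcoef0; apply: base_puis.
by rewrite raddf0 scaler0 subrr.
Qed.

Lemma resolvableD b u v : resolvable b u -> resolvable b v -> resolvable b (u + v).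
Proof.
move=> [w wP <-] [w' w'P <-]; exists (w + w'); first exact: puis_coefsD.
by rewrite raddfD /= scalerDr opprD addrACA.
Qed.

Lemma resolvableZ b m u : resolvable b u -> resolvable b (cst m *: u).
Proof.
move=> [w wP <-]; exists (cst m *: w); first by apply: puis_coefsZ => //; apply: base_puis.
by rewrite PhiZ phi_cst scalerBr !scalerA (mulrC (cst m)).
Qed.

(* Induction along [lower]: each case exhibits [w] such that [Phi w - b w]
   is the wanted term up to lower ones. Exponents [< 0] are absorbed by a new
   letter in front of [s], and the resonant constants [b = gen_eigen k] by
   raising [alpha_1], or the power of [ell] if [s] is empty. *)
Lemma resolvable_gen (b : algC) k x : b != 0 -> puis x -> resolvable b (x *: E k).
Proof.
move=> b0; elim/lower_ind: k x => k IHk.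
have IHr r : puis_coefs r -> (forall k', mcoef k' r != 0 -> lower k' k) -> resolvable b r.
  move=> rP rlow; apply: M_ind => [||k' rk'].
  - exact: resolvable0.
  - exact: resolvableD.
  - by apply: IHk; [apply: rlow|].
(* If [w] produces [y E_k] up to lower terms [r], a solution for [r] is available by induction and
   is subtracted. *)
have finish w y r : puis_coefs w -> puis_coefs r ->
    (forall k', mcoef k' r != 0 -> lower k' k) ->
    Phi w - cst b *: w = y *: E k + r -> resolvable b (y *: E k).
  move=> wP rP rlow wE; have <- : (y *: E k + r) + cst (-1) *: r = y *: E k.
    by rewrite rmorphN1 scaleN1r addrK.
  by apply: resolvableD; [exists w|apply/resolvableZ/IHr].
have finish_base w (m : algC) y r : m != 0 -> puis_coefs w ->
    base_on (fun k' => lower k' k) r ->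
    Phi w - cst b *: w = (cst m * y) *: E k + r ->
    forall m', resolvable b ((cst m' * y) *: E k).
  move=> m0 wP rlow wE m'.
  have -> : (cst m' * y) *: E k = cst (m' / m) *: ((cst m * y) *: E k).
    by rewrite scalerA mulrA -rmorphM divfK.
  apply: resolvableZ; apply: finish wE => //; first exact: puis_coefs_base rlow.
  by move=> k'; case: (rlow k').
apply: puis_ind => [x y|x xP|m|m a].
- by rewrite scalerDl; apply: resolvableD.
- have [h hP hx] := xP (gen_eigen k) b b0.
  have [r rlow rE] := gen_shiftE k.
  apply: (finish (h *: E k) x (phi h *: r)).
  + by apply: puis_coefsZ => //; apply: puis_coefsE.
  + by apply: puis_coefsZ; [apply: puis_phi|apply: puis_coefs_base rlow].
  + by move=> k'; rewrite mcoefZ mulf_eq0 negb_or => /andP[_]; case: (rlow k').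
  rewrite PhiZ PhiE rE scalerDr !scalerA addrAC -scalerBl -hx.
  by rewrite (mulrC (phi h)).
- rewrite -(mulr1 (cst m)).
  (* Off resonance [E_k] itself serves, the factor [gen_eigen k - b] being nonzero. *)
  have [bE|bE] := eqVneq (gen_eigen k) b; last first.
    have [r rlow rE] := gen_shiftE k.
    apply: (finish_base (E k) (gen_eigen k - b) 1 r) => //.
    + by rewrite subr_eq0.
    + exact: puis_coefsE.
    + by rewrite PhiE rE mulr1 rmorphB scalerBl addrAC.
  case: k bE {IHk IHr finish} finish_base => [[c j] [|[[al la] a] s]] bE finish.
    (* Resonance with the empty word: [(ell + 1)^(j+1) - ell^(j+1)] has top term [(j+1) ell^j], so
       raising the power of [ell] yields [b (j+1)] times the generator. *)
    rewrite /gen_eigen /word_prod /= big_nil mulr1 in bE.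
    pose r := cst b *: \sum_(i < j) cst 'C(j.+1, i)%:R *: E (c, i : nat, [::]).
    apply: (finish (E (c, j.+1, [::])) (b * j.+1%:R) 1 r).
    + by rewrite mulf_neq0 ?pnatr_eq0.
    + exact: puis_coefsE.
    + apply: base_onZ => //; apply: base_on_sum => i _; apply: base_onZ => //.
      by apply: base_onE; rewrite /lower ltn_ord.
    rewrite PhiE /gen_shift /= bE !big_ord_recr /= binn rmorph1 scale1r.
    by rewrite binSn !scalerDr addrK addrC mulr1 rmorphM scalerA.
  (* Resonance with a nonempty word: raising [alpha_1 = al] keeps the eigenvalue, the diagonal terms
     cancel, and the binomial term [be = al] yields [b (al + 1)] times the generator. *)
  have [r0 r0low r0E] := gen_shift_topE c j ((al.+1, la, a) :: s).
  pose r := cst b *: (mono a *: E (c, j, s) + \sum_(be < al)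
     cst 'C(al.+1, be)%:R *: E (c, j, (be : nat, la, a) :: s)) + r0.
  apply: (finish (E (c, j, (al.+1, la, a) :: s)) (b * al.+1%:R) 1 r).
  + by rewrite mulf_neq0 ?pnatr_eq0.
  + exact: puis_coefsE.
  + apply: base_onD; last by apply: base_onS r0low => -[[c' j'] s'] /= ->.
    apply: base_onZ => //; apply: base_onD.
      by apply: base_onZ => //; apply: base_onE; rewrite /lower /= ltnSn eqxx orbT.
    apply: base_on_sum => i _; apply: base_onZ => //; apply: base_onE.
    by rewrite /lower /= !eqxx !ltnn /= ltn_ord.
  have wE : word_prod ((al.+1, la, a) :: s) = word_prod ((al, la, a) :: s).
    by rewrite /word_prod !big_cons.
  rewrite PhiE r0E /xi_shift wE scalerA -rmorphM [sval c * _]bE.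
  rewrite !big_ord_recr /= binn rmorph1 scale1r binSn mulr1 rmorphM -scalerA /r.
  have rearrange (A S B W r1 : M) : cst b *: (A + (S + B + W)) + r1 - cst b *: W =
      cst b *: B + (cst b *: (A + S) + r1).
    by rewrite addrA scalerDr addrAC addrK (addrA A) [A + S + B]addrC scalerDr -addrA.
  exact: rearrange.
(* The new letter has [alpha = 0] and [lambda = b / cs], so that its eigenvalue is [b]: the diagonal
   terms cancel and [b] times [mono a] remains. *)
- case: k {IHk IHr finish} finish_base => [[c j] s] finish.
  pose cs := sval c * word_prod s.
  have cs0 : cs != 0 by rewrite mulf_neq0 ?word_prod_neq0 // (svalP c).
  have la0 : b / cs != 0 by rewrite mulf_neq0 ?invr_eq0.
  pose s1 : seq letter := (0%N, exist (fun x : algC => x != 0) _ la0, a) :: s.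
  have [r rlow rE] := gen_shift_topE c j s1.
  apply: (finish (E (c, j, s1)) b (mono a) r) => //.
  + exact: puis_coefsE.
  + by apply: base_onS rlow => -[[c' j'] s'] /= ->.
  have wE : sval c * word_prod s1 = b.
    by rewrite /s1 /word_prod big_cons /= -/(word_prod s) mulrCA -/cs divfK.
  rewrite PhiE rE /xi_shift {1}/s1 scalerA -rmorphM wE big_ord1 bin0 rmorph1 scale1r.
  by rewrite scalerDr scalerA -addrA [in X in _ + X]addrC addrA addrK.
Qed.

Lemma resolvable_puis (b : algC) u : b != 0 -> puis_coefs u -> resolvable b u.
Proof.
move=> b0 uP; apply: M_ind => [||k _]; [exact: resolvable0|exact: resolvableD|].
exact: resolvable_gen.
Qed.

Lemma mcoef_sum k I (r : seq I) (P : pred I) (G : I -> M) :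
  mcoef k (\sum_(i <- r | P i) G i) = \sum_(i <- r | P i) mcoef k (G i).
Proof. exact: (big_morph _ (mcoefD k) (mcoef0 k)). Qed.

(** * Operators as polynomials, right factors and conjugation *)

Definition mahler_op (P : {poly F}) v : M := \sum_(i < size P) P`_i *: iter i Phi v.

Lemma mahler_opEw n P v : (size P <= n)%N ->
  mahler_op P v = \sum_(i < n) P`_i *: iter i Phi v.
Proof.
move=> szP; rewrite /mahler_op (big_ord_widen n (fun i => P`_i *: iter i Phi v)) // big_mkcond.
by apply: eq_bigr => i _; case: ltnP => // /(nth_default 0) ->; rewrite scale0r.
Qed.

Lemma iter_PhiZ i x v : iter i Phi (x *: v) = iter i phi x *: iter i Phi v.
Proof. by elim: i => // i IHi; rewrite !iterS IHi PhiZ. Qed.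

Lemma iter_phi_cst i b : iter i phi (cst b) = cst b.
Proof. by elim: i => // i IHi; rewrite iterS IHi phi_cst. Qed.

Lemma iter_PhiB i u v : iter i Phi (u - v) = iter i Phi u - iter i Phi v.
Proof. by elim: i => // i IHi; rewrite !iterS IHi raddfB. Qed.

(** The commutative product of polynomials agrees here with composition of operators because [phi]
    fixes constants. *)
Lemma mahler_op_mulXsubC P b v :
  mahler_op (P * ('X - (cst b)%:P)) v = mahler_op P (Phi v - cst b *: v).
Proof.
rewrite (@mahler_opEw (size P).+1); last first.
  by apply: leq_trans (size_polyMleq _ _) _; rewrite size_XsubC addn2.
rewrite mulrBr; under eq_bigr do rewrite coefB coefMX coefMC scalerBl.
rewrite sumrB big_ord_recl /= scale0r add0r [X in _ - X]big_ord_recr /=.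
rewrite nth_default // mul0r scale0r addr0 -sumrB; apply: eq_bigr => i _.
by rewrite iter_PhiB iter_PhiZ iter_phi_cst scalerBr scalerA -iterSr.
Qed.

Definition twist (f : F) (P : {poly F}) := \poly_(i < size P) (P`_i * iter i phi f).

Lemma iter_phi_eq0 i f : (iter i phi f == 0) = (f == 0).
Proof. by elim: i => // i IHi; rewrite iterS fmorph_eq0. Qed.

Lemma size_twist f P : f != 0 -> size (twist f P) = size P.
Proof.
move=> f0; have [->|P0] := eqVneq P 0.
  by rewrite /twist size_poly0 poly_def big_ord0 size_poly0.
by apply: size_poly_eq; rewrite mulf_neq0 ?iter_phi_eq0 // -lead_coefE lead_coef_eq0.
Qed.

Lemma mahler_op_scale f P v : mahler_op P (f *: v) = mahler_op (twist f P) v.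
Proof.
rewrite (@mahler_opEw (size P) (twist f P)) ?size_poly //; apply: eq_bigr => i _.
by rewrite coef_poly ltn_ord iter_PhiZ scalerA.
Qed.

(** * Evaluation in [R] and the basis of solutions *)

Variable ev : {additive M -> R}.
Hypothesis evZ : forall x v, ev (x *: v) = iota x * ev v.
Hypothesis evE : forall k, ev (E k) = iota (word k.2) * e k.1.1 * ell ^+ k.1.2.

Lemma ev_xi_shift c j s :
  ev (xi_shift c j s) = iota (phi (word s)) * e c * ell ^+ j.
Proof.
case: s => [|[[al la] a] s]; first by rewrite /= evE /= word_nil !rmorph1.
rewrite /= evZ raddfD raddf_sum /= phi_word_cons evZ evE /= !rmorphM -!mulrA.
congr (_ * _); rewrite rmorphD rmorphM rmorph_sum mulrDl mulr_suml /= !mulrA.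
congr (_ + _); apply: eq_bigr => i _.
by rewrite evZ evE /= rmorphM !mulrA.
Qed.

Lemma ev_Phi v : ev (Phi v) = sigma (ev v).
Proof.
apply: (M_ind (Q := fun v => ev (Phi v) = sigma (ev v))) => [|u w uP wP|k _].
- by rewrite !raddf0.
- by rewrite !raddfD /= uP wP.
move: (mcoef k v) => x; case: k => [[c j] s].
rewrite PhiZ PhiE !evZ evE /= !rmorphM rmorphXn /= !sigma_iota sigma_e sigma_ell.
rewrite raddf_sum /= addrC exprDn; congr (_ * _).
rewrite [X in _ = X * _]mulrCA -[RHS]mulrA; congr (_ * _).
rewrite mulr_sumr; apply: eq_bigr => i _.
by rewrite evZ ev_xi_shift expr1n mul1r !rmorph_nat mulrnAr mulr_natl.
Qed.

(* Conjugating by a solution [f e_c] of [P] makes [X - c] a right factor of [P]. *)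
Lemma formal_basis d P : size P = d.+1 -> P`_0 != 0 -> (forall i, puis P`_i) ->
  exists Y : 'I_d -> M, [/\ forall i, puis_coefs (Y i), forall i, mahler_op P (Y i) = 0
    & forall g : 'I_d -> algC, \sum_i iota (cst (g i)) * ev (Y i) = 0 ->
        forall i, g i = 0].
Proof.
elim: d P => [|d IHd] P szP P0 PP.
  by exists (fun=> 0); split=> [[]|[]|g _ []].
have [|c [f [c0 f0 fP cf]]] := right_factor _ P0 PP; first by rewrite szP.
(* That [e_c f] solves [P] means that [c] is a root of [twist f P]. *)
have [Q QE] : exists Q, twist f P = Q * ('X - (cst c)%:P).
  apply/factor_theorem/rootP; rewrite horner_poly -[RHS]cf.
  by apply: eq_bigr => i _; rewrite rmorphXn mulrAC.
have szQ : size Q = d.+1.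
  have := size_twist P f0; rewrite QE szP size_Mmonic ?monicXsubC //.
    by rewrite size_XsubC addn2 => -[].
  apply/eqP => Q0; move: QE; rewrite Q0 mul0r => /(congr1 (fun S : {poly F} => size S)).
  by rewrite (size_twist P f0) szP size_poly0.
have QP i : puis Q`_i.
  (* Division by [X - c] from the top: [Q_i] is obtained from [Q_(i+1)]. *)
  have [n] := ubnP (size Q - i); elim: n i => // n IHn i lt_n.
  have [/(nth_default 0) ->|ltiQ] := leqP (size Q) i; first exact: base_puis.
  have -> : Q`_i = (twist f P)`_i.+1 + cst c * Q`_i.+1.
    by rewrite QE mulrBr coefB coefMX coefMC /= mulrC subrK.
  apply: puisD.
    rewrite coef_poly; case: ifP => _; last exact: base_puis.
    by apply: puisM => //; elim: i.+1 => // l; apply: puis_phi.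
  by apply: puisM; [apply: base_puis|apply: IHn; lia].
have Q0 : Q`_0 != 0.
  apply: contraNneq P0 => Q0; have := congr1 (fun S : {poly F} => S`_0) QE.
  rewrite /= mulrBr coefB coefMX coefMC /= Q0 mul0r subrr coef_poly szP /= => /eqP.
  by rewrite mulf_eq0 (negPf f0) orbF.
have [U [UP UQ Ufree]] := IHd Q szQ Q0 QP.
have /choice[W WP] i : exists w, puis_coefs w /\ Phi w - cst c *: w = U i.
  by have [w wP wE] := resolvable_puis c0 (UP i); exists w.
pose cz : nzC := exist (fun x : algC => x != 0) c c0.
(* [w0] stands for [e_c], which [Phi - c] kills; the [W i] lift the solutions [U i] of [Q]. *)
pose w0 := E (cz, 0%N, [::]).
have w0E : Phi w0 - cst c *: w0 = 0.
  by rewrite PhiE /gen_shift /= big_ord1 bin0 rmorph1 scale1r subrr.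
pose Z i := if unlift ord0 i is Some i' then W i' else w0.
have ZP i : puis_coefs (Z i).
  by rewrite /Z; case: unlift => [i'|]; [case: (WP i')|apply: puis_coefsE].
exists (fun i => f *: Z i); split.
- by move=> i; apply: puis_coefsZ.
- move=> i; rewrite mahler_op_scale QE mahler_op_mulXsubC /Z.
  case: unlift => [i'|]; first by case: (WP i') => _ ->.
  by rewrite w0E /mahler_op big1 // => l _; rewrite -(scale0r 0) iter_PhiZ
    (eqP (_ : iter l phi 0 == 0)) ?iter_phi_eq0 // !scale0r scaler0.
move=> g gY.
have {}gY : \sum_i iota (cst (g i)) * ev (Z i) = 0.
  rewrite -[LHS]mul1r -(rmorph1 iota) -(mulVf f0) rmorphM -mulrA mulr_sumr.
  rewrite -[RHS](mulr0 (iota f^-1)) -[in RHS]gY; congr (_ * _); apply: eq_bigr => i _.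
  by rewrite evZ mulrCA.
(* Applying [sigma - c] kills the term of [e_c] and turns the others into a relation between the
   values of the [U i]. *)
have gU : \sum_i iota (cst (g (lift ord0 i))) * ev (U i) = 0.
  set S := \sum_i _ in gY.
  transitivity (sigma S - iota (cst c) * S); last by rewrite gY rmorph0 mulr0 subrr.
  rewrite /S rmorph_sum mulr_sumr -sumrB big_ord_recl.
  have diffE i : sigma (iota (cst (g i)) * ev (Z i)) -
      iota (cst c) * (iota (cst (g i)) * ev (Z i)) =
      iota (cst (g i)) * ev (Phi (Z i) - cst c *: Z i).
    by rewrite rmorphM sigma_iota phi_cst raddfB /= evZ ev_Phi mulrBr (mulrCA (iota (cst c))).
  rewrite diffE /Z unlift_none w0E raddf0 mulr0 add0r.
  by apply: eq_bigr => i _; rewrite diffE /Z liftK; case: (WP i) => _ ->.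
have g0 i : g (lift ord0 i) = 0 by apply: (Ufree (fun i => g (lift ord0 i))).
move=> i; case: (unliftP ord0 i) => [i' ->|->]; first exact: g0.
(* What remains is [g_0 e_c = 0], with [e_c] invertible. *)
move: gY; rewrite big_ord_recl big1 => [|l _]; last by rewrite g0 !rmorph0 mul0r.
rewrite addr0 /Z unlift_none evE /= word_nil rmorph1 mul1r expr0 mulr1.
have [u ue] := e_inv cz => /(congr1 (fun x => x * u)).
rewrite mul0r -mulrA (mulrC _ u) ue mulr1 => /eqP.
by rewrite !fmorph_eq0 => /eqP.
Qed.

(** * The coefficients of a solution are p-Mahler *)

Hypothesis mcoef_finite : forall v, exists ks : seq gen_index,
  forall k, mcoef k v != 0 -> k \in ks.

Lemma finN x : fin x -> fin (- x).
Proof. by move=> xF; rewrite -mulN1r -(rmorphN1 cst); apply: finM. Qed.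

(** By triangularity, coordinate [k] of [Phi v] is the diagonal term plus K_inf-multiples of images
    under [phi] of coordinates above [k]. *)
Lemma fin_coef_Phi v k :
  (forall k', lower k k' -> fin (mcoef k' v)) ->
  fin (mcoef k (Phi v) - cst (gen_eigen k) * phi (mcoef k v)).
Proof.
move=> vF.
apply: (M_ind (Q := fun v => fin (mcoef k (Phi v) - cst (gen_eigen k) * phi (mcoef k v))))
  => [|u w uF wF|k' vk'].
- by rewrite raddf0 mcoef0 rmorph0 mulr0 subrr.
- by rewrite raddfD !mcoefD rmorphD mulrDr opprD addrACA; apply: finD.
rewrite PhiZ PhiE; have [r rlow ->] := gen_shiftE k'.
rewrite !mcoefZ mcoefD mcoefZ mcoefE [phi (_ * _)]rmorphM /= rmorph_nat.
have [rK rk] := rlow k.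
have [kk'|kk'] := eqVneq k k'; last first.
  rewrite mulr0n !mulr0 subr0 add0r mulrC.
  have [->|r0] := eqVneq (mcoef k r) 0; first by rewrite mul0r.
  by apply: finM => //; apply/fin_phi/vF/rk.
have -> : mcoef k r = 0 by apply/eqP/negPn/negP => /rk; rewrite kk' lower_irr.
by rewrite -kk' !mulr1 addr0 mulrC subrr.
Qed.

Lemma fin_coef_iter_Phi n v k :
  (forall k', lower k k' -> fin (mcoef k' v)) ->
  (forall k', lower k k' -> fin (mcoef k' (iter n Phi v))) /\
  fin (mcoef k (iter n Phi v) - cst (gen_eigen k ^+ n) * iter n phi (mcoef k v)).
Proof.
move=> vF; elim: n => [|n [IHup IHn]].
  by split=> //=; rewrite expr0 rmorph1 mul1r subrr.
rewrite !iterS; set w := iter n Phi v in IHup IHn *; split.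
  move=> k' kk'; have := @fin_coef_Phi w k'.
  move=> /(_ (fun k'' k'k'' => IHup k'' (lower_trans kk' k'k''))) wF.
  rewrite -(subrK (cst (gen_eigen k') * phi (mcoef k' w)) (mcoef k' (Phi w))).
  by apply: finD => //; apply: finM => //; apply/fin_phi/IHup.
have := fin_coef_Phi IHup; set y := mcoef k w in IHn *; set z := iter n phi _ in IHn *.
move=> wF; have -> : mcoef k (Phi w) - cst (gen_eigen k ^+ n.+1) * phi z =
    (mcoef k (Phi w) - cst (gen_eigen k) * phi y) +
    cst (gen_eigen k) * phi (y - cst (gen_eigen k ^+ n) * z).
  rewrite [phi (_ - _)]rmorphB [phi (_ * _)]rmorphM /= phi_cst exprS.
  by rewrite [cst (_ * _)]rmorphM /=; ring.
by apply: finD => //; apply: finM => //; apply: fin_phi.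
Qed.

(** Modulo coordinates above [k], already treated, coordinate [k] of the equation is a scalar Mahler
    equation whose coefficients are those of [P] times powers of [gen_eigen k]. *)
Lemma fin_coef_solution P v : P != 0 -> (forall i, base P`_i) ->
  mahler_op P v = 0 -> forall k, fin (mcoef k v).
Proof.
move=> P0 PK Pv; have [ks ksP] := mcoef_finite v => k.
(* The induction counts the indices of [ks] above [k]; passing to such a [k'] loses at least [k']
   itself. *)
have [n] := ubnP (count (lower k) ks); elim: n k => // n IHn k lt_n.
have up k' : lower k k' -> fin (mcoef k' v).
  move=> kk'; have [->|/ksP k'ks] := eqVneq (mcoef k' v) 0; first exact: fin0.
  apply: IHn; rewrite -ltnS; apply: leq_trans lt_n; rewrite ltnS -!size_filter.
  have sub : subpred (lower k') (lower k).
    by move=> k'' /(lower_trans kk').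
  have -> : [seq x <- ks | lower k' x] = [seq x <- [seq x <- ks | lower k x] | lower k' x].
    rewrite -filter_predI; apply: eq_filter => x /=.
    by case lx: (lower k' x) => //=; rewrite (sub _ lx).
  rewrite size_filter ltn_neqAle count_size andbT -all_count; apply/negP => /allP.
  by move=> /(_ k'); rewrite mem_filter kk' k'ks lower_irr => /(_ isT).
pose a i := P`_i * cst (gen_eigen k ^+ i).
apply: (@fin_solution (size P).-1 a).
- by move=> i; apply: baseM.
- by rewrite mulf_neq0 ?fmorph_eq0 ?expf_neq0 ?gen_eigen_neq0 // -lead_coefE lead_coef_eq0.
rewrite prednK ?size_poly_gt0 //.
have -> : \sum_(i < size P) a i * iter i phi (mcoef k v) =
    - \sum_(i < size P) P`_i * (mcoef k (iter i Phi v) -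
        cst (gen_eigen k ^+ i) * iter i phi (mcoef k v)).
  have := congr1 (mcoef k) Pv; rewrite mcoef0 mcoef_sum => Pvk.
  rewrite -[LHS]subr0 -[X in _ - X]Pvk -sumrB -sumrN; apply: eq_bigr => i _.
  by rewrite mcoefZ /a; ring.
apply: finN; elim/big_ind: _ => // i _; apply: finM => //.
by case: (fin_coef_iter_Phi i up).
Qed.

End FormalModule.

(** * The free module on the symbols *)

Local Notation M := {malg F[gen_index]}.

Let E (k : gen_index) : M := << 1 *g k >>.
Let mcoef (k : gen_index) (v : M) : F := v@_k.
Let Phi : {additive M -> M} := semilinear_ext phi (gen_shift E).
Let ev : {additive M -> R} :=
  malg_ring_ext iota (fun k => iota (word k.2) * e k.1.1 * ell ^+ k.1.2).

Lemma mahler_solutions d (P : {poly F}) :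
  size P = d.+1 -> P`_0 != 0 -> (forall i, base P`_i) ->
  exists (y : 'I_d -> R) (Y : 'I_d -> gen_index -> F) (ks : 'I_d -> {fset gen_index}),
  [/\ forall i k, [/\ Y i k != 0 -> k \in ks i, puis (Y i k) & fin (Y i k)],
      forall i, y i = \sum_(k <- ks i)
        iota (Y i k) * (iota (word k.2) * e k.1.1 * ell ^+ k.1.2),
      forall i, \sum_(l < d.+1) iota P`_l * iter l sigma (y i) = 0
    & forall g : 'I_d -> algC, \sum_i iota (cst (g i)) * y i = 0 -> forall i, g i = 0].
Proof.
move=> szP P0 PK.
have mD k : {morph mcoef k : u v / u + v} by move=> u v; apply: mcoeffD.
have mZ k x v : mcoef k (x *: v) = x * mcoef k v by apply: mcoeffZ.
have mE k k' : mcoef k (E k') = (k == k')%:R.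
  by rewrite /mcoef mcoeffU eq_sym; case: (k == k').
have mind (Q : M -> Prop) : Q 0 -> (forall u v, Q u -> Q v -> Q (u + v)) ->
    forall v, (forall k, mcoef k v != 0 -> Q (mcoef k v *: E k)) -> Q v.
  move=> Q0 QD v Qv; apply: malg_ind => // k /Qv.
  by rewrite scale_malgU mulr1.
have PhZ x v : Phi (x *: v) = phi x *: Phi v by apply: semilinear_extZ.
have PhE k : Phi (E k) = gen_shift E k.
  by rewrite [LHS]semilinear_extU rmorph1 scale1r.
have eZ x v : ev (x *: v) = iota x * ev v by apply: malg_ring_extZ.
have eE k : ev (E k) = iota (word k.2) * e k.1.1 * ell ^+ k.1.2.
  by rewrite [LHS]malg_ring_extU rmorph1 mul1r.
have mfin v : exists ks : seq gen_index, forall k, mcoef k v != 0 -> k \in ks.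
  by exists (msupp v) => k; rewrite mcoeff_neq0.
have ePhi v : ev (Phi v) = sigma (ev v).
  exact: (ev_Phi mind PhZ PhE eZ eE).
have [Y [YP YE Yfree]] := formal_basis mD mZ mE mind PhZ PhE eZ eE szP P0
  (fun i => base_puis (PK i)).
exists (fun i => ev (Y i)), (fun i k => mcoef k (Y i)), (fun i => msupp (Y i)).
split=> // i.
  move=> k; split; [by rewrite mcoeff_neq0|exact: YP|].
  apply: (fin_coef_solution mD mZ mE mind PhZ PhE mfin _ PK (YE i)).
  by rewrite -size_poly_gt0 szP.
have iterE l : iter l sigma (ev (Y i)) = ev (iter l Phi (Y i)).
  by elim: l => // l IHl; rewrite !iterS IHl ePhi.
have := congr1 ev (YE i); rewrite raddf0 raddf_sum szP => Ei; rewrite -[RHS]Ei.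
by apply: eq_bigr => l _; rewrite iterE [RHS]eZ.
Qed.

End FormalSeries.

(** * Application to Hahn series *)

(** On a grid only finitely many exponents of a Hahn series are nonpositive; they are removed one by
    one, starting from the lowest. *)
Lemma in_puiseux_ind (Q : hahn -> Prop) :
  (forall x y, Q x -> Q y -> Q (x + y)) ->
  (forall x, in_puiseux x -> (forall q, x q != 0 -> 0 < q) -> Q x) ->
  (forall b (q : rat), q <= 0 -> Q (hmonom b q)) ->
  forall x, in_puiseux x -> Q x.
Proof.
move=> QD Qpos Qmon x /in_puiseuxP[k k0 xk].
have kr0 : 0 < k%:R :> rat by rewrite ltr0n.
have [n xn] : exists n : nat, forall q, x q != 0 -> - n%:R / k%:R < q.
  have [->|/supp_min[m _ mmin]] := eqVneq x 0.
    by exists 0%N => q; rewrite hcoef0 eqxx.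
  exists (Num.bound `|m * k%:R|) => q /mmin; apply: lt_le_trans.
  rewrite ltr_pdivrMr // ltrNl; apply: le_lt_trans (ler_norm _) _.
  by rewrite normrN; apply: archi_boundP (normr_ge0 _).
elim: n x xk xn => [|n IHn] x xk xn.
  apply: Qpos; first by apply/in_puiseuxP; exists k.
  by move=> q /xn; rewrite oppr0 mul0r.
pose q0 : rat := - n%:R / k%:R.
rewrite -(subrK (hmonom (x q0) q0) x); apply: QD; last first.
  by apply: Qmon; rewrite /q0 mulNr oppr_le0 divr_ge0.
apply: IHn.
  apply: on_gridD => //; apply/on_gridN/on_grid_monom.
  by rewrite gridE divfK ?gt_eqF // rpredN natr_int.
move=> q; rewrite hcoefD hcoefN /=; case: (q =P q0) => [->|/eqP q_neq].
  by rewrite subrr eqxx.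
rewrite subr0 => xq; have := xn q xq; have /intrP[l lE] := xk q xq.
have qE : q = l%:~R / k%:R by rewrite -lE mulfK ?gt_eqF.
have kV0 : k%:R^-1 != 0 :> rat by rewrite invr_eq0 gt_eqF.
move: q_neq; rewrite /q0 qE (inj_eq (mulIf kV0)).
have nE m : - m%:R = (- m%:Z)%:~R :> rat by rewrite mulrNz.
by rewrite !ltr_pM2r ?invr_gt0 // !nE eqr_int !ltr_int; lia.
Qed.

Theorem theorem1p5 (p : nat) (p_gt1 : (1 < p)%N)
    (R : comNzRingType) (iota : {rmorphism hahn -> R})
    (sigma : {rmorphism R -> R})
    (iota_inj : injective iota)
    (sigma_bij : bijective sigma)
    (sigma_iota : forall f : hahn, sigma (iota f) = iota (phi p_gt1 f))
    (constants : forall x : R,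
       sigma x = x <-> exists c : algC, x = iota (hconst c))
    (ell : R) (sigma_ell : sigma ell = ell + 1)
    (e : nzC -> R)
    (e_inv : forall c : nzC, exists u : R, u * e c = 1)
    (sigma_e : forall c : nzC, sigma (e c) = iota (hconst (sval c)) * e c)
    (d : nat) (a : 'I_d.+1 -> hahn) (a_mahler : mahler_coefs a) :
  exists y : 'I_d -> R,
    [/\ forall j, gen_mahler p_gt1 iota ell e (y j),
        forall j, \sum_(i < d.+1) iota (a i) * iter i sigma (y j) = 0
      & forall c : 'I_d -> algC,
          \sum_(j < d) iota (hconst (c j)) * y j = 0 -> forall j, c j = 0].
Proof.
have [aK a0] := a_mahler.
pose mono (r : posQ) := hmonom 1 (- sval r).
have mono_K r : in_Kinf (mono r) by apply/in_Kinf_monomN/(svalP r).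
have puis_ind (Q : hahn -> Prop) : (forall x y, Q x -> Q y -> Q (x + y)) ->
    (forall x, (forall m c : algC, c != 0 -> exists2 h, in_puiseux h &
       hconst m * phi p_gt1 h - hconst c * h = x) -> Q x) ->
    (forall b, Q (hconst b)) -> (forall b r, Q (hconst b * mono r)) ->
    forall x, in_puiseux x -> Q x.
  move=> QD Qsol Qcst Qmono; apply: in_puiseux_ind => // [x xP xpos|b q].
    (* Divided by [-c], the equation becomes [h - (m/c) phi(h) = -x/c], a contracting one with
       [d = 1]. *)
    apply: Qsol => m c c0.
    have bP i : (i < 1)%N -> supp_ge 0 (hconst (- m / c)) /\ in_puiseux (hconst (- m / c)).
      move=> _; split; last exact: in_puiseux_const.
      by move=> q /=; case: (q =P 0) => [->//|_]; rewrite eqxx.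
    have gP : in_puiseux (hconst (- c^-1) * x).
      by apply: in_puiseuxM => //; apply: in_puiseux_const.
    have gpos q : (hconst (- c^-1) * x) q != 0 -> 0 < q.
      by rewrite hcoef_constM mulf_eq0 negb_or => /andP[_ /xpos].
    have [h [hP _ hE]] :=
      in_puiseux_fixpoint p_gt1 (b := fun=> hconst (- m / c)) bP gP gpos.
    exists h => //; rewrite big_ord1 /= in hE.
    apply: (mulfI (_ : hconst (- c^-1) != 0)); first by rewrite hconst_eq0 oppr_eq0 invr_eq0.
    rewrite -hE mulrBr !mulrA -!rmorphM [RHS]addrC; congr (_ + _).
      by congr (hconst _ * _); rewrite mulNr mulNr mulrC.
    by rewrite mulNr mulVf // rmorphN1 mulN1r opprK.
  rewrite le_eqVlt => /predU1P[->|q0]; first exact: Qcst.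
  have q0' : 0 < - q by rewrite oppr_gt0.
  have := Qmono b (exist (fun q : rat => 0 < q) (- q) q0').
  by rewrite /mono /= hmonomM mulr1 add0r opprK.
pose P : {poly hahn} := \poly_(i < d.+1) a (inord i).
have PE (i : 'I_d.+1) : P`_i = a i by rewrite coef_poly ltn_ord inord_val.
have szP : size P = d.+1.
  apply: size_poly_eq; rewrite (_ : inord d = ord_max); last first.
    by apply: val_inj; rewrite /= inordK.
  by apply: contraNneq a0 => ->; rewrite mulr0.
have P0 : P`_0 != 0.
  by rewrite (PE ord0); apply: contraNneq a0 => ->; rewrite mul0r.
have PK i : in_Kinf P`_i by rewrite coef_poly; case: ifP => // _; apply: in_Kinf0.
have [y [Y [ks [YP yE yeq yfree]]]] :=
  @mahler_solutions hahn (phi p_gt1) hconst mono in_Kinf in_puiseux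
    (phi_const p_gt1) in_Kinf_const mono_K in_KinfD in_KinfM in_puiseux_Kinf
    in_puiseuxD in_puiseuxM (@in_puiseux_phi p p_gt1) puis_ind
    (@mahler_right_factor p p_gt1) R iota sigma ell e (word_xi p_gt1)
    sigma_iota sigma_ell sigma_e e_inv (word_xi_nil p_gt1)
    (phi_word_xi_cons p_gt1) (phi_finite p_gt1) (phi_finite0 p_gt1)
    (@phi_finiteD p p_gt1) (@phi_finiteM p p_gt1) (@phi_finite_phi p p_gt1)
    (@phi_finite_solution p p_gt1) d P szP P0 PK.
exists y; split=> // j; last first.
  by rewrite -[RHS](yeq j); apply: eq_bigr => i _; rewrite PE.
(* [h] and [h'] exchange the indices over [Lambda] with those over words, so the finite sum over
   [ks j] becomes the one in [gen_mahler]. *)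
pose h (i : nzC * nat * Lambda) : gen_index := (i.1.1, i.1.2, Lambda_word i.2).
pose h' (k : gen_index) : nzC * nat * Lambda := (k.1.1, k.1.2, word_Lambda k.2).
have hK : cancel h h' by case=> [[c n] w]; rewrite /h /h' /= Lambda_wordK.
have h'K : cancel h' h by case=> [[c n] s]; rewrite /h /h' /= word_LambdaK.
exists (fun i => Y j (h i)); split.
- apply: (@sub_finite_set _ _ (h' @` [set` ks j])); last exact/finite_image/finite_fset.
  by move=> i Yi; exists (h i); rewrite ?hK //; case: (YP j (h i)) => /(_ Yi).
- move=> i; have [_ YPu YF] := YP j (h i); split=> //.
  exact: phi_finite_mahler.
rewrite (@reindex_fsbigT _ _ _ _ _ h'); last by exists h.
rewrite (@fsumT_fset _ _ [set` ks j]); last first.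
- move=> k; case: (YP j k) => Yk _ _; apply: contra_neqP => nk; rewrite h'K.
  have [->|/Yk //] := eqVneq (Y j k) 0.
  by rewrite rmorph0 !mul0r.
- exact: finite_fset.
by rewrite set_fsetK yE; apply: eq_bigr => k _; rewrite h'K !mulrA.
Qed.
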